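(* The space of polynomial $\mathcal G^{F_4}$-invariants over its basic module, that is, $\{f\in\mathcal A\mid u(f)=0\text{ for all }u\in\mathcal G^{F_4}\}$ with $\mathcal A=\mathbb C[x_1,\dots,x_{26}]$, is the subalgebra of $\mathcal A$ generated by $\eta_1$ and $\eta_2$.
   Context: Notation: $\bar r=27-r$ for $1\le r\le 26$. All Lie algebras are over $\mathbb C$. The Lie algebra of type $E_6$. Let $\alpha_1,\dots,\alpha_6$ be the simple roots of $E_6$, with Dynkin diagram edges $1-3$, $3-4$, $4-5$, $5-6$, $2-4$. Let $Q=\sum_i\mathbb Z\alpha_i$ with symmetric bilinear form $(\alpha_i,\alpha_i)=2$, $(\alpha_i,\alpha_j)=-1$ if $i,j$ are adjacent and $0$ otherwise for $i\ne j$, and let $\Phi=\{\alpha\in Q\mid(\alpha,\alpha)=2\}$. Put $$F\Big(\sum_i k_i\alpha_i,\sum_j l_j\alpha_j\Big)=(-1)^{\sum_{i=1}^6k_il_i+k_1l_3+k_4l_2+k_3l_4+k_5l_4+k_6l_5}.$$ Let $H=\bigoplus_i\mathbb C\alpha_i$ (with the form extended bilinearly) and $\mathcal G^{E_6}=H\oplus\bigoplus_{\alpha\in\Phi}\mathbb CE_\alpha$, with bracket $[H,H]=0$, $[h,E_\alpha]=-[E_\alpha,h]=(h,\alpha)E_\alpha$, $[E_\alpha,E_{-\alpha}]=-\alpha$, and, for $\beta\neq-\alpha$, $[E_\alpha,E_\beta]=F(\alpha,\beta)E_{\alpha+\beta}$ if $\alpha+\beta\in\Phi$ and $0$ otherwise.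 Let $\sigma$ be the automorphism of $Q$ with $\sigma(\sum k_i\alpha_i)=k_6\alpha_1+k_2\alpha_2+k_5\alpha_3+k_4\alpha_4+k_3\alpha_5+k_1\alpha_6$. It extends linearly to $H$ and induces an automorphism $\hat\sigma$ of $\mathcal G^{E_6}$ of order 2 by $\hat\sigma(E_\alpha)=E_{\sigma(\alpha)}$ and $\hat\sigma|_H=\sigma$. The Lie algebra of type $F_4$ and its basic module. $\mathcal G^{F_4}=\{u\in\mathcal G^{E_6}\mid\hat\sigma(u)=u\}$ is the simple Lie algebra of type $F_4$, with Cartan subalgebra spanned by $h_1=\alpha_2$, $h_2=\alpha_4$, $h_3=\alpha_3+\alpha_5$, $h_4=\alpha_1+\alpha_6$ (the simple coroots); $\lambda_1,\dots,\lambda_4$ are the corresponding fundamental weights: $\lambda_i(h_j)=\delta_{ij}$. The positive root vectors of $\mathcal G^{F_4}$ are the elements $E_\alpha$ for positive $\alpha\in\Phi$ with $\sigma(\alpha)=\alpha$, and $E_\alpha+E_{\sigma(\alpha)}$ for positive $\alpha\in\Phi$ with $\sigma(\alpha)\ne\alpha$. The space $V=\{w\in\mathcal G^{E_6}\mid\hat\sigma(w)=-w\}$, with the adjoint action of $\mathcal G^{F_4}$, is the basic 26-dimensional irreducible module. It has basis $x_1,\dots,x_{26}$, where for $1\le r\le12$ $$x_r=E_{\beta_r}-E_{\sigma(\beta_r)},\qquad x_{27-r}=E_{-\beta_r}-E_{-\sigma(\beta_r)},$$ $\beta_1=\alpha_1+\alpha_2+2\alpha_3+2\alpha_4+\alpha_5+\alpha_6$,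 $\beta_2=\alpha_1+\alpha_2+2\alpha_3+2\alpha_4+\alpha_5$, $\beta_3=\alpha_1+\alpha_2+\alpha_3+2\alpha_4+\alpha_5$, $\beta_4=\alpha_1+\alpha_2+\alpha_3+\alpha_4+\alpha_5$, $\beta_5=\alpha_1+\alpha_2+\alpha_3+\alpha_4$, $\beta_6=\alpha_1+\alpha_3+\alpha_4+\alpha_5$, $\beta_7=\alpha_2+\alpha_3+\alpha_4$, $\beta_8=\alpha_1+\alpha_3+\alpha_4$, $\beta_9=\alpha_3+\alpha_4$, $\beta_{10}=\alpha_1+\alpha_3$, $\beta_{11}=\alpha_3$, $\beta_{12}=\alpha_1$, and $x_{13}=\alpha_1-\alpha_6$, $x_{14}=\alpha_3-\alpha_5$. The vector $x_1$ is a highest weight vector of $V$, of weight $\lambda_4$. The polynomial representation. $\mathcal A=\mathbb C[x_1,\dots,x_{26}]$ is the polynomial algebra in the $x_r$ treated as commuting variables; $\mathcal G^{F_4}$ acts on $\mathcal A$ by derivations extending its action on $V=\sum_r\mathbb Cx_r$. A singular vector is a weight vector in $\mathcal A$ annihilated by all positive root vectors. The special polynomials. $$\eta_1=3\sum_{r=1}^{12}x_rx_{\bar r}-x_{13}^2-x_{13}x_{14}-x_{14}^2,$$ $$\zeta_1=x_1(2x_{13}+x_{14})-3x_2x_{12}-3x_3x_{10}+3x_4x_8-3x_5x_6.$$ The polynomial $\zeta_1$ is a singular vector of weight $\lambda_4$, so it generates a submodule isomorphic to $V$; for $1\le r\le26$ let $\zeta_r$ be the image of $x_r$ under the unique $\mathcal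 G^{F_4}$-module isomorphism from $V$ onto this submodule sending $x_1$ to $\zeta_1$. Finally $$\eta_2=3\sum_{r=1}^{12}(\zeta_rx_{\bar r}+x_r\zeta_{\bar r})-2x_{13}\zeta_{13}-x_{13}\zeta_{14}-x_{14}\zeta_{13}-2x_{14}\zeta_{14}.$$ *)

(* Defs.v *)
From HB Require Import structures.
From mathcomp Require Import all_boot all_order all_algebra.
From mathcomp Require Import ring lra zify.
From mathcomp Require Import classical_sets reals.
From mathcomp Require Import complex mpoly.

Set Implicit Arguments.
Unset Strict Implicit.
Unset Printing Implicit Defensive.

Import Order.TTheory GRing.Theory Num.Theory.
Local Open Scope ring_scope.

(* Labels are 1-based as in the usual numbering of the Dynkin diagram of E6;  *)
(* the label i is the index i.-1 : 'I_6.  Rows in 'rV[R]_6 are coordinates    *)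
(* in the basis alpha_1, ..., alpha_6 of simple roots.                        *)

Definition E6_edges : seq (nat * nat) :=
  [:: (1, 3); (3, 4); (4, 5); (5, 6); (2, 4)]%N.

Definition cartan (i j : 'I_6) : int :=
  if i == j then 2
  else if ((i.+1, j.+1) \in E6_edges) || ((j.+1, i.+1) \in E6_edges) then -1
  else 0.

Section Coordinates.
Variable R : pzRingType.
Implicit Types a b : 'rV[R]_6.

Definition E6form a b : R :=
  \sum_(i < 6) \sum_(j < 6) a 0 i * b 0 j * (cartan i j)%:~R.

Definition row6 (k1 k2 k3 k4 k5 k6 : R) : 'rV[R]_6 :=
  \row_(i < 6) nth 0 [:: k1; k2; k3; k4; k5; k6] i.

Definition cf a (i : nat) : R := a 0 (inord i.-1).

Definition sigma a : 'rV[R]_6 :=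
  row6 (cf a 6) (cf a 2) (cf a 5) (cf a 4) (cf a 3) (cf a 1).

Definition alpha (i : nat) : 'rV[R]_6 := delta_mx 0 (inord i.-1).

End Coordinates.

Arguments alpha {R} i.

Definition rootlattice := 'rV[int]_6.

Definition eps_exponent (a b : rootlattice) : int :=
  \sum_(i < 6) a 0 i * b 0 i
  + cf a 1 * cf b 3 + cf a 4 * cf b 2 + cf a 3 * cf b 4
  + cf a 5 * cf b 4 + cf a 6 * cf b 5.

Definition is_root (a : rootlattice) : bool := E6form a a == 2.

Definition E6root := {a : rootlattice | is_root a}.

Lemma formE (a : rootlattice) : E6form a a =
  2 * (cf a 1 ^+ 2 + cf a 2 ^+ 2 + cf a 3 ^+ 2
     + cf a 4 ^+ 2 + cf a 5 ^+ 2 + cf a 6 ^+ 2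
     - cf a 1 * cf a 3 - cf a 3 * cf a 4 - cf a 4 * cf a 5
     - cf a 5 * cf a 6 - cf a 2 * cf a 4).
Proof.
pose c := cf a.
have E : forall i : 'I_6, a 0 i = c i.+1.
  by move=> i; rewrite /c /cf /= inord_val.
rewrite /E6form; under eq_bigr do under eq_bigr do rewrite !E.
rewrite !big_ord_recl !big_ord0 /cartan /= -/c.
rewrite /bump /=; ring.
Qed.

(* The coefficients of a root lie in {-3, ..., 3}, whence finiteness. *)
Lemma root_bound (a : rootlattice) (i : 'I_6) :
  is_root a -> -3 <= a 0 i <= 3.
Proof.
rewrite /is_root formE => /eqP.
have -> : a 0 i = cf a i.+1 by rewrite /cf /= inord_val.
have small (x : int) : x * x <= 12 -> -3 <= x <= 3 by nia.
have sq (x : int) : 0 <= x * x by nia.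
have -> : cf a i.+1 = nth 0 [:: cf a 1; cf a 2; cf a 3; cf a 4; cf a 5; cf a 6] i.
  by case: i => [[|[|[|[|[|[|]]]]]]].
move: (cf a 1) (cf a 2) (cf a 3) (cf a 4) (cf a 5) (cf a 6)
  => a1 a2 a3 a4 a5 a6 E; apply: small.
case: i => [[|[|[|[|[|[|//]]]]]] _] /=.
- have := (sq (2*a2 - a4), sq (- a1 + 2*a3 - a4), sq (- a1 + 2*a4 - 2*a5), sq (- a1 + 2*a5 - 2*a6), sq (- a1 + 2*a6)).
  move=> [[[[]]]]; lra.
- have := (sq (2*a1 - a3), sq (3*a3 - 2*a4), sq (-3*a2 + 4*a4 - 3*a5), sq (-3*a2 + 5*a5 - 4*a6), sq (- a2 + 2*a6)).
  move=> [[[[]]]]; lra.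
- have := (sq (2*a1 - a3), sq (2*a2 - a4), sq (-2*a3 + 3*a4 - 2*a5), sq (-2*a3 + 4*a5 - 3*a6), sq (-2*a3 + 5*a6)).
  move=> [[[[]]]]; lra.
- have := (sq (2*a1 - a3), sq (2*a2 - a4), sq (3*a3 - 2*a4), sq (- a4 + 2*a5 - a6), sq (- a4 + 3*a6)).
  move=> [[[[]]]]; lra.
- have := (sq (2*a1 - a3), sq (2*a2 - a4), sq (3*a3 - 2*a4), sq (5*a4 - 6*a5), sq (- a5 + 2*a6)).
  move=> [[[[]]]]; lra.
- have := (sq (2*a1 - a3), sq (2*a2 - a4), sq (3*a3 - 2*a4), sq (5*a4 - 6*a5), sq (4*a5 - 5*a6)).
  move=> [[[[]]]]; lra.
Qed.

HB.instance Definition _ := [isSub for @sval rootlattice is_root : E6root -> rootlattice].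
HB.instance Definition _ := [Countable of E6root by <:].

Definition root_code (a : E6root) : {ffun 'I_6 -> 'I_7} :=
  [ffun i => inord (absz (val a 0 i + 3))].

Definition root_decode (c : {ffun 'I_6 -> 'I_7}) : option E6root :=
  insub (\row_i ((c i)%:Z - 3)).

Lemma root_codeK : pcancel root_code root_decode.
Proof.
move=> a; rewrite /root_decode.
have -> : \row_i ((root_code a i)%:Z - 3) = val a; last by rewrite valK.
apply/rowP => i; rewrite mxE ffunE.
have /andP[lo hi] := root_bound i (valP a).
have bnd : (absz (val a 0 i + 3)%R < 7)%N.
  by move: (val a 0 i) lo hi => x lo hi; lia.
rewrite inordK // gez0_abs; last by rewrite -lerBlDr sub0r.
by rewrite addrK.
Qed.

HB.instance Definition _ : isFinite E6root := PCanIsFinite root_codeK.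

(* The Lie algebra of type E6 over K: the component in H, in the basis of     *)
(* simple roots, and the coefficients of the root vectors.                    *)
Definition E6 (K : fieldType) : Type := ('rV[K]_6 * {ffun E6root -> K^o})%type.
HB.instance Definition _ (K : fieldType) :=
  Vector.copy (E6 K) ('rV[K]_6 * {ffun E6root -> K^o})%type.

Section E6_F4.
Variable K : fieldType.
Local Notation E6 := (E6 K).

Definition toH (a : rootlattice) : 'rV[K]_6 := map_mx intr a.

Definition Hvec (h : 'rV[K]_6) : E6 := (h, 0).

(* This is 0 when a is not a root. *)
Definition Evec (a : rootlattice) : E6 := (0, [ffun b => (val b == a)%:R]).

Definition bracketE (a b : rootlattice) : E6 :=
  if a + b == 0 then Hvec (- toH a)
  else if is_root (a + b) then (-1) ^ (eps_exponent a b) *: Evec (a + b)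
  else 0.

Definition bracket (u v : E6) : E6 :=
  \sum_(b : E6root) (E6form u.1 (toH (val b)) * v.2 b) *: Evec (val b)
  - \sum_(a : E6root) (E6form v.1 (toH (val a)) * u.2 a) *: Evec (val a)
  + \sum_(a : E6root) \sum_(b : E6root)
      (u.2 a * v.2 b) *: bracketE (val a) (val b).

Definition sigma_hat (u : E6) : E6 :=
  Hvec (sigma u.1) + \sum_(a : E6root) u.2 a *: Evec (sigma (val a)).

Definition in_F4 (u : E6) : Prop := sigma_hat u = u.

Definition in_V (w : E6) : Prop := sigma_hat w = - w.

Definition beta (r : nat) : rootlattice :=
  nth 0 [:: row6 1 1 2 2 1 1; row6 1 1 2 2 1 0; row6 1 1 1 2 1 0;
            row6 1 1 1 1 1 0; row6 1 1 1 1 0 0; row6 1 0 1 1 1 0;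
            row6 0 1 1 1 0 0; row6 1 0 1 1 0 0; row6 0 0 1 1 0 0;
            row6 1 0 1 0 0 0; row6 0 0 1 0 0 0; row6 1 0 0 0 0 0] r.-1.

Definition xvec (r : nat) : E6 :=
  if (r <= 12)%N then Evec (beta r) - Evec (sigma (beta r))
  else if r == 13%N then Hvec (alpha 1 - alpha 6)
  else if r == 14%N then Hvec (alpha 3 - alpha 5)
  else Evec (- beta (27 - r)) - Evec (- sigma (beta (27 - r))).

Definition xbasis : 26.-tuple E6 := [tuple xvec r.+1 | r < 26].

Local Notation A := {mpoly K[26]}.

(* For w in V, the polynomial of degree 1 identified with w. *)
Definition linpoly (w : E6) : A := \sum_(r < 26) coord xbasis r w *: 'X_r.

(* For u in the algebra of type F4, the derivation of A that extends ad u.    *)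
Definition F4_act (u : E6) (f : A) : A :=
  \sum_(r < 26) linpoly (bracket u (tnth xbasis r)) * f^`M(r).

Definition F4_invariant (f : A) : Prop := forall u, in_F4 u -> F4_act u f = 0.

Definition generated_submodule (g f : A) : Prop :=
  forall S : {pred A}, GRing.submod_closed S ->
    (forall u h, in_F4 u -> h \in S -> F4_act u h \in S) ->
    g \in S -> f \in S.

Definition generated_subalgebra (gs : seq A) (f : A) : Prop :=
  forall S : {pred A}, GRing.subalg_closed S -> {subset gs <= S} -> f \in S.

Definition xvar (r : nat) : A := 'X_(inord r.-1).

Definition eta1 : A :=
  3 * (\sum_(1 <= r < 13) xvar r * xvar (27 - r))
  - xvar 13 ^+ 2 - xvar 13 * xvar 14 - xvar 14 ^+ 2.

Definition zeta1 : A :=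
  xvar 1 * (2 * xvar 13 + xvar 14) - 3 * xvar 2 * xvar 12 - 3 * xvar 3 * xvar 10
  + 3 * xvar 4 * xvar 8 - 3 * xvar 5 * xvar 6.

(* The linear map V -> A with x_r |-> z_r. *)
Definition linext (z : {ffun 'I_26 -> A}) (w : E6) : A :=
  \sum_(r < 26) coord xbasis r w *: z r.

(* linext z is a module isomorphism from V onto the submodule generated by    *)
(* zeta1, and it maps x_1 to zeta1.                                           *)
Definition is_zeta (z : {ffun 'I_26 -> A}) : Prop :=
  [/\ linext z (xvec 1) = zeta1,
      forall u w, in_F4 u -> in_V w ->
        linext z (bracket u w) = F4_act u (linext z w),
      forall w w', in_V w -> in_V w' -> linext z w = linext z w' -> w = w'
    & forall f, generated_submodule zeta1 f <->
        exists2 w, in_V w & linext z w = f].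

(* For K of characteristic 0 there is exactly one z such that is_zeta z;      *)
(* xget selects it (its default value 0 is then not used).                    *)
Definition zeta_family : {ffun 'I_26 -> A} := xget 0 is_zeta.

Definition zeta (r : nat) : A := zeta_family (inord r.-1).

Definition eta2 : A :=
  3 * (\sum_(1 <= r < 13) (zeta r * xvar (27 - r) + xvar r * zeta (27 - r)))
  - 2 * xvar 13 * zeta 13 - xvar 13 * zeta 14 - xvar 14 * zeta 13
  - 2 * xvar 14 * zeta 14.

End E6_F4.

Arguments eta1 {K}.
Arguments eta2 {K}.

(* Main.v *)
Require Import Defs.
From Stdlib Require Import ZArith.
From mathcomp Require Import all_boot all_order all_algebra.
From mathcomp Require Import perm.
From mathcomp Require Import ring zify ssrZ.
From mathcomp Require Import boolp classical_sets.
From mathcomp Require Import reals complex mpoly.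

(** The zero weight space of V is the plane spanned by x_13 and x_14, and the
    theorem is a Chevalley restriction theorem for this plane: setting the
    other 24 variables to zero ([restriction]) maps the invariants injectively
    to polynomials in two variables, the image is fixed by a group S_3
    generated by reflections, and eta_1, eta_2 restrict to generators of the
    ring of these symmetric polynomials.

    Injectivity ([invariant_eq0]).  Let f be invariant, and suppose that all
    monomials of f have degree at least k >= 1 in the 24 variables of nonzero
    weight.  If x_r is one of them, the root vector of opposite weight acts as
    l d/dx_r + D, where l is a nonzero linear form in x_13 and x_14, and where D
    does not lower that degree.  Hence l df/dx_r, and then df/dx_r, has degree
    at least k in the 24 variables; as this holds for all r, the degree of f is
    at least k + 1.  So an invariant all of whose monomials have positive degree
    in these variables is 0.

    Symmetry ([reflections]).  If e and e' are opposite root vectors for one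
    of the two simple roots that are the weights of x_11 and x_12, then the
    reflection on the plane is exp(e) exp(e') exp(e).  Exponentials are
    replaced by polynomial curves: along a curve whose velocity is the value of
    the vector field of e, the derivative of f is the value of e(f) = 0, so f
    takes the same value at both ends ([flow_invariance]).

    Generation ([invariant_generated]).  With x_13 = t_0 - t_1 and
    x_14 = t_1 - t_2 the reflections become transpositions of the t_i, so by the
    fundamental theorem the restriction of f is a polynomial in the elementary
    symmetric functions of t_0, t_1, t_2.  Choosing t_0 + t_1 + t_2 = 0, the
    other two are the restrictions of eta_1 / 3 and eta_2 / 27; the same
    polynomial in eta_1 / 3 and eta_2 / 27 is an invariant with the restriction
    of f, hence it is f.

    Conversely eta_1 and eta_2 are invariant ([eta1_invariant],
    [eta2_invariant]).  Everything that concerns the actual structure constants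
    is verified by evaluation over the integers: 52 generators of the Lie algebra
    of type F4 act on x_1, ..., x_26 by integral matrices ([table]), the
    polynomials zeta_r arise from zeta_1 by applying a chain of generators that
    leads from x_1 to all x_r ([chain]), and the required identities are
    identities between integral polynomials in the x_r. *)

Set Implicit Arguments.
Unset Strict Implicit.
Unset Printing Implicit Defensive.

Import Order.TTheory GRing.Theory Num.Theory.
Local Open Scope ring_scope.

(* The key Z delimits the scope of int. *)
Delimit Scope Z_scope with zz.
Local Notation iz := int_of_Z.

(** * Roots of E6 in binary integers *)

(** Coordinates with respect to the simple roots.  On such tuples a statement
    about finitely many roots reduces to true by evaluation. *)
Definition zvec : Type := (Z * Z * Z * Z * Z * Z)%type.

Definition zform (p q : zvec) : Z :=
  let: (a1, a2, a3, a4, a5, a6) := p in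
  let: (b1, b2, b3, b4, b5, b6) := q in
  (a1 * (2 * b1 - b3) + a2 * (2 * b2 - b4) + a3 * (2 * b3 - b1 - b4)
   + a4 * (2 * b4 - b2 - b3 - b5) + a5 * (2 * b5 - b4 - b6)
   + a6 * (2 * b6 - b5))%zz.

Definition zroot (p : zvec) : bool := Z.eqb (zform p p) 2%zz.

Definition zadd (p q : zvec) : zvec :=
  let: (a1, a2, a3, a4, a5, a6) := p in
  let: (b1, b2, b3, b4, b5, b6) := q in
  (a1 + b1, a2 + b2, a3 + b3, a4 + b4, a5 + b5, a6 + b6)%zz.

Definition zscale (c : Z) (p : zvec) : zvec :=
  let: (a1, a2, a3, a4, a5, a6) := p in
  (c * a1, c * a2, c * a3, c * a4, c * a5, c * a6)%zz.

Definition zsigma (p : zvec) : zvec :=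
  let: (a1, a2, a3, a4, a5, a6) := p in (a6, a2, a5, a4, a3, a1).

Definition zeps (p q : zvec) : Z :=
  let: (a1, a2, a3, a4, a5, a6) := p in
  let: (b1, b2, b3, b4, b5, b6) := q in
  (a1 * b1 + a2 * b2 + a3 * b3 + a4 * b4 + a5 * b5 + a6 * b6
   + a1 * b3 + a4 * b2 + a3 * b4 + a5 * b4 + a6 * b5)%zz.

Definition zsign (p q : zvec) : Z := if Z.even (zeps p q) then 1%zz else (-1)%zz.

Definition zeqv (p q : zvec) : bool :=
  let: (a1, a2, a3, a4, a5, a6) := p in
  let: (b1, b2, b3, b4, b5, b6) := q in
  [&& Z.eqb a1 b1, Z.eqb a2 b2, Z.eqb a3 b3, Z.eqb a4 b4, Z.eqb a5 b5
    & Z.eqb a6 b6].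

Definition zzero : zvec := (0, 0, 0, 0, 0, 0)%zz.

Lemma zeqvP p q : reflect (p = q) (zeqv p q).
Proof.
case: p q => [[[[[a1 a2] a3] a4] a5] a6] [[[[[b1 b2] b3] b4] b5] b6] /=.
apply: (iffP idP) => [|[-> -> -> -> -> ->]]; last by rewrite !Z.eqb_refl.
by do 5![case/andP => /Z.eqb_eq ->]; move/Z.eqb_eq => ->.
Qed.

Definition vrow (p : zvec) : rootlattice :=
  let: (a1, a2, a3, a4, a5, a6) := p in
  row6 (iz a1) (iz a2) (iz a3) (iz a4) (iz a5) (iz a6).

Definition zcode (a : rootlattice) : zvec :=
  (Z_of_int (cf a 1), Z_of_int (cf a 2), Z_of_int (cf a 3),
   Z_of_int (cf a 4), Z_of_int (cf a 5), Z_of_int (cf a 6)).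

Lemma cf_row6 (R : pzRingType) (k1 k2 k3 k4 k5 k6 : R)
    (k := row6 k1 k2 k3 k4 k5 k6) :
  ((cf k 1 = k1) * (cf k 2 = k2) * (cf k 3 = k3)
   * (cf k 4 = k4) * (cf k 5 = k5) * (cf k 6 = k6))%type.
Proof. by rewrite /cf !mxE !inordK. Qed.

Lemma row6_cf (R : pzRingType) (a : 'rV[R]_6) :
  a = row6 (cf a 1) (cf a 2) (cf a 3) (cf a 4) (cf a 5) (cf a 6).
Proof.
apply/rowP => i; rewrite mxE /cf.
case: i => [[|[|[|[|[|[|//]]]]]] lt] /=; congr (a _ _);
by apply: val_inj; rewrite /= inordK.
Qed.

Lemma zcodeK : cancel zcode vrow.
Proof. by move=> a; rewrite /= !Z_of_intK -row6_cf. Qed.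

Lemma vrowK : cancel vrow zcode.
Proof.
case=> [[[[[a1 a2] a3] a4] a5] a6].
by rewrite /zcode /vrow !cf_row6 !int_of_ZK.
Qed.

Lemma vrow_eq p q : (vrow p == vrow q) = zeqv p q.
Proof.
apply/eqP/zeqvP => [|-> //]; exact: (can_inj vrowK).
Qed.

Lemma E6formE (R : comNzRingType) (a b : 'rV[R]_6) : E6form a b =
  cf a 1 * (2 * cf b 1 - cf b 3) + cf a 2 * (2 * cf b 2 - cf b 4)
  + cf a 3 * (2 * cf b 3 - cf b 1 - cf b 4)
  + cf a 4 * (2 * cf b 4 - cf b 2 - cf b 3 - cf b 5)
  + cf a 5 * (2 * cf b 5 - cf b 4 - cf b 6) + cf a 6 * (2 * cf b 6 - cf b 5).
Proof.
have E (c : 'rV[R]_6) (i : 'I_6) : c 0 i = cf c i.+1 by rewrite /cf /= inord_val.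
rewrite /E6form; under eq_bigr do under eq_bigr do rewrite !E.
by rewrite !big_ord_recl !big_ord0 /cartan /= /bump /=; ring.
Qed.

Lemma iz_add a b : iz (Z.add a b) = iz a + iz b. Proof. exact: (rmorphD iz). Qed.
Lemma iz_mul a b : iz (Z.mul a b) = iz a * iz b. Proof. exact: (rmorphM iz). Qed.
Lemma iz_opp a : iz (Z.opp a) = - iz a. Proof. exact: (rmorphN iz). Qed.
Lemma iz_sub a b : iz (Z.sub a b) = iz a - iz b. Proof. exact: (rmorphB iz). Qed.
Definition izE := (iz_add, iz_mul, iz_opp, iz_sub).

Lemma E6form_vrow p q : E6form (vrow p) (vrow q) = iz (zform p q).
Proof.
rewrite E6formE.
case: p q
  => [[[[[a1 a2] a3] a4] a5] a6] [[[[[b1 b2] b3] b4] b5] b6].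
by rewrite /vrow !cf_row6 /zform !izE.
Qed.

Lemma is_root_vrow p : is_root (vrow p) = zroot p.
Proof.
by rewrite /is_root E6form_vrow /zroot -[2](erefl : iz 2%zz =
  2) (inj_eq (can_inj int_of_ZK)).
Qed.

Lemma eps_vrow p q : eps_exponent (vrow p) (vrow q) = iz (zeps p q).
Proof.
rewrite /eps_exponent.
have E (c : rootlattice) (i : 'I_6) : c 0 i = cf c i.+1 by rewrite /cf /= inord_val.
under eq_bigr do rewrite !E.
case: p q
  => [[[[[a1 a2] a3] a4] a5] a6] [[[[[b1 b2] b3] b4] b5] b6].
rewrite !big_ord_recl big_ord0 /bump.
by rewrite /vrow !cf_row6 /zeps !izE; ring.
Qed.

(** Only the parity of the exponent matters. *)
Lemma sign_vrow (K : fieldType) p q :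
  (-1) ^ (eps_exponent (vrow p) (vrow q)) = (iz (zsign p q))%:~R :> K.
Proof.
rewrite eps_vrow /zsign; move: (zeps p q) => n.
have [k [b nE]] : exists k (b : bool), n = Z.add (Z.mul 2 k) (Z.b2z b).
  by exists (Z.div2 n), (Z.odd n); exact: Z.div2_odd.
have -> : Z.even n = ~~ b by rewrite nE Z.add_comm Z.even_add_mul_2; case: (b).
rewrite nE !izE expfzDr ?oppr_eq0 ?oner_eq0 //.
rewrite -exprz_exp -[iz 2]/(Posz 2) -exprnP sqrrN expr1n exp1rz mul1r.
by case: (b).
Qed.

Lemma map_row6 (R S : pzRingType) (f : R -> S) k1 k2 k3 k4 k5 k6 :
  map_mx f (row6 k1 k2 k3 k4 k5 k6) = row6 (f k1) (f k2) (f k3) (f k4) (f k5) (f k6).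
Proof.
by apply/rowP => i; rewrite !mxE; case: i => [[|[|[|[|[|[|//]]]]]] lt].
Qed.

Lemma vrow_add p q : vrow (zadd p q) = vrow p + vrow q.
Proof.
case: p q => [[[[[a1 a2] a3] a4] a5] a6] [[[[[b1 b2] b3] b4] b5] b6] /=.
apply/rowP => i; rewrite !mxE !izE.
by case: i => [[|[|[|[|[|[|//]]]]]] lt].
Qed.

Lemma vrow_scale c p : vrow (zscale c p) = iz c *: vrow p.
Proof.
case: p => [[[[[a1 a2] a3] a4] a5] a6] /=.
apply/rowP => i; rewrite !mxE !izE.
by case: i => [[|[|[|[|[|[|//]]]]]] lt].
Qed.

Lemma vrow0 : vrow zzero = 0.
Proof.
by apply/rowP => i; rewrite !mxE; case: i => [[|[|[|[|[|[|//]]]]]] lt].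
Qed.

Lemma vrow_sigma p : vrow (zsigma p) = sigma (vrow p).
Proof.
by case: p => [[[[[a1 a2] a3] a4] a5] a6]; rewrite /sigma /vrow !cf_row6.
Qed.

(** * Bilinearity of the bracket, and integral elements *)

(** The pair (h, e) stands for h in the Cartan subalgebra plus the sum of the
    c E_p over (c, p) in e.  A root may occur several times in e. *)
Definition zelt : Type := (zvec * seq (Z * zvec))%type.

Section Bracket.
Variable K : fieldType.
Local Notation E6 := (E6 K).
Local Notation Evec := (Evec K).
Implicit Types (u v w : E6) (c : K).

Lemma E6form_linear_l c (a b d : 'rV[K]_6) :
  E6form (c *: a + b) d = c * E6form a d + E6form b d.
Proof. by rewrite !E6formE /cf !mxE; ring. Qed.

Lemma sum_linear (V : lmodType K) (I : finType) c (F G H : I -> V) :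
  (forall i, F i = c *: G i + H i) ->
  \sum_i F i = c *: (\sum_i G i) + \sum_i H i.
Proof. by move=> E; rewrite scaler_sumr -big_split; apply: eq_bigr. Qed.

Lemma sum_scale_linear (V : lmodType K) (I : finType) c (x y z : I -> K)
    (F : I -> V) : (forall i, x i = c * y i + z i) ->
  \sum_i x i *: F i = c *: (\sum_i y i *: F i) + \sum_i z i *: F i.
Proof. by move=> E; apply: sum_linear => i; rewrite E scalerDl scalerA. Qed.

Lemma snd_linear c u v (b : E6root) : (c *: u + v).2 b = c * u.2 b + v.2 b.
Proof. by rewrite [LHS]ffunE [X in X + _]ffunE. Qed.

Lemma addBACA (V : zmodType) (a1 a2 b1 b2 c1 c2 : V) :
  (a1 + a2) - (b1 + b2) + (c1 + c2) = (a1 - b1 + c1) + (a2 - b2 + c2).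
Proof. by rewrite opprD (addrACA a1) [LHS]addrACA. Qed.

Lemma bracket_linear_l c u v w :
  bracket (c *: u + v) w = c *: bracket u w + bracket v w.
Proof.
rewrite /bracket !scalerDr scalerN -addBACA; congr (_ - _ + _).
- by apply: sum_scale_linear => b; rewrite E6form_linear_l; ring.
- by apply: sum_scale_linear => b; rewrite snd_linear; ring.
- by apply: sum_linear => a; apply: sum_scale_linear => b; rewrite snd_linear; ring.
Qed.

Lemma bracket_linear_r c u v w :
  bracket w (c *: u + v) = c *: bracket w u + bracket w v.
Proof.
rewrite /bracket !scalerDr scalerN -addBACA; congr (_ - _ + _).
- by apply: sum_scale_linear => b; rewrite snd_linear; ring.
- by apply: sum_scale_linear => b; rewrite E6form_linear_l; ring.
- by apply: sum_linear => a; apply: sum_scale_linear => b; rewrite snd_linear; ring.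
Qed.

Lemma bracket0l w : bracket 0 w = 0.
Proof.
by have := bracket_linear_l (-1) 0 0 w; rewrite scaler0 addr0 scaleN1r addNr.
Qed.

Lemma bracket0r w : bracket w 0 = 0.
Proof.
by have := bracket_linear_r (-1) 0 0 w; rewrite scaler0 addr0 scaleN1r addNr.
Qed.

Lemma bracketDl u v w : bracket (u + v) w = bracket u w + bracket v w.
Proof. by rewrite -[u]scale1r bracket_linear_l !scale1r. Qed.

Lemma bracketDr u v w : bracket w (u + v) = bracket w u + bracket w v.
Proof. by rewrite -[u]scale1r bracket_linear_r !scale1r. Qed.

Lemma bracketZl c u w : bracket (c *: u) w = c *: bracket u w.
Proof. by rewrite -[c *: u]addr0 bracket_linear_l bracket0l addr0. Qed.

Lemma bracketZr c u w : bracket w (c *: u) = c *: bracket w u.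
Proof. by rewrite -[c *: u]addr0 bracket_linear_r bracket0r addr0. Qed.

Lemma bracket_suml (T : Type) (s : seq T) (F : T -> E6) w :
  bracket (\sum_(i <- s) F i) w = \sum_(i <- s) bracket (F i) w.
Proof.
by apply: (big_morph (fun u => bracket u w)) => [u v|]; rewrite ?bracketDl ?bracket0l.
Qed.

Lemma bracket_sumr (T : Type) (s : seq T) (F : T -> E6) w :
  bracket w (\sum_(i <- s) F i) = \sum_(i <- s) bracket w (F i).
Proof.
by apply: (big_morph (bracket w)) => [u v|]; rewrite ?bracketDr ?bracket0r.
Qed.

(** Selects one term of the sums over all roots in the definitions of the
    bracket and of [sigma_hat]. *)
Lemma sum_Evec (V : lmodType K) (a : E6root) (g : E6root -> K) (F : E6root -> V) :
  \sum_b (g b * (Evec (val a)).2 b) *: F b = g a *: F a.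
Proof.
rewrite (bigD1 a) //= ffunE eqxx mulr1 big1 ?addr0 // => b ne.
by rewrite ffunE (negPf (_ : val b != val a)) ?mulr0 ?scale0r // (inj_eq val_inj).
Qed.

Lemma E6form0l (a : 'rV[K]_6) : E6form 0 a = 0.
Proof. by rewrite E6formE /cf !mxE; ring. Qed.

Lemma bracketHE (h : 'rV[K]_6) (a : E6root) :
  bracket (Hvec h) (Evec (val a)) = E6form h (toH K (val a)) *: Evec (val a).
Proof.
rewrite /bracket sum_Evec /=.
rewrite big1 => [|b _]; last by rewrite ffunE mulr0 scale0r.
rewrite [X in _ + X]big1 => [|b _]; first by rewrite subr0 addr0.
by rewrite big1 // => d _; rewrite ffunE mul0r scale0r.
Qed.

Lemma bracketEH (h : 'rV[K]_6) (a : E6root) :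
  bracket (Evec (val a)) (Hvec h) = - (E6form h (toH K (val a)) *: Evec (val a)).
Proof.
rewrite /bracket sum_Evec /=.
rewrite big1 => [|b _]; last by rewrite ffunE mulr0 scale0r.
rewrite [X in _ + X]big1 => [|b _]; first by rewrite sub0r addr0.
by rewrite big1 // => d _; rewrite [X in _ * X]ffunE mulr0 scale0r.
Qed.

Lemma bracketHH (h k : 'rV[K]_6) : bracket (Hvec h) (Hvec k) = 0.
Proof.
rewrite /bracket /= big1 => [|b _]; last by rewrite ffunE mulr0 scale0r.
rewrite big1 => [|b _]; last by rewrite ffunE mulr0 scale0r.
rewrite big1 => [|b _]; first by rewrite subr0 addr0.
by rewrite big1 // => d _; rewrite ffunE mul0r scale0r.
Qed.

Lemma bracketEE (a b : E6root) :
  bracket (Evec (val a)) (Evec (val b)) = bracketE K (val a) (val b).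
Proof.
rewrite /bracket /= big1 => [|d _]; last by rewrite E6form0l mul0r scale0r.
rewrite big1 => [|d _]; last by rewrite E6form0l mul0r scale0r.
rewrite subr0 add0r.
transitivity (\sum_d ((Evec (val a)).2 d) *: bracketE K (val d) (val b)).
  apply: eq_bigr => d _.
  exact: (@sum_Evec _ b (fun=> (Evec (val a)).2 d) (fun e => bracketE K (val d) (val e))).
transitivity (\sum_d (1 * (Evec (val a)).2 d) *: bracketE K (val d) (val b)).
  by apply: eq_bigr => d _; rewrite mul1r.
by rewrite (@sum_Evec _ a (fun=> 1) (fun e => bracketE K (val e) (val b))) scale1r.
Qed.

Definition ofZ (z : Z) : K := (iz z)%:~R.

Definition elt_of (m : zelt) : E6 :=
  Hvec (toH K (vrow m.1)) + \sum_(t <- m.2) ofZ t.1 *: Evec (vrow t.2).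

Lemma ofZ_add a b : ofZ (Z.add a b) = ofZ a + ofZ b.
Proof. by rewrite /ofZ iz_add rmorphD. Qed.
Lemma ofZ_mul a b : ofZ (Z.mul a b) = ofZ a * ofZ b.
Proof. by rewrite /ofZ iz_mul rmorphM. Qed.
Lemma ofZ_opp a : ofZ (Z.opp a) = - ofZ a.
Proof. by rewrite /ofZ iz_opp rmorphN. Qed.

Lemma HvecD (h k : 'rV[K]_6) : Hvec (h + k) = Hvec h + Hvec k.
Proof. by congr pair; apply/ffunP => b; rewrite !ffunE addr0. Qed.
Lemma HvecZ c (h : 'rV[K]_6) : Hvec (c *: h) = c *: Hvec h.
Proof. by congr pair; apply/ffunP => b; rewrite !ffunE scaler0. Qed.

Lemma toH_add p q : toH K (vrow (zadd p q)) = toH K (vrow p) + toH K (vrow q).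
Proof. by rewrite vrow_add /toH map_mxD. Qed.

Lemma toH_scale (d : Z) p : toH K (vrow (zscale d p)) = ofZ d *: toH K (vrow p).
Proof. by rewrite vrow_scale /toH map_mxZ. Qed.

Lemma toH_form p q : E6form (toH K (vrow p)) (toH K (vrow q)) = ofZ (zform p q).
Proof.
by rewrite /ofZ -E6form_vrow !E6formE /toH /cf !mxE; ring.
Qed.

End Bracket.

Arguments elt_of K m : simpl never.

(** * Brackets of integral elements *)

Definition zelt0 : zelt := (zzero, [::]).
Definition zelt_add (m n : zelt) : zelt := (zadd m.1 n.1, m.2 ++ n.2).
Definition zelt_scale (c : Z) (m : zelt) : zelt :=
  (zscale c m.1, [seq (Z.mul c t.1, t.2) | t <- m.2]).
Definition zelt_sigma (m : zelt) : zelt :=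
  (zsigma m.1, [seq (t.1, zsigma t.2) | t <- m.2]).
Definition zelt_roots (m : zelt) : bool := all (fun t => zroot t.2) m.2.

Definition zbracketEE (t s : Z * zvec) : zelt :=
  let r := zadd t.2 s.2 in
  if zeqv r zzero then (zscale (Z.opp (Z.mul t.1 s.1)) t.2, [::])
  else if zroot r then (zzero, [:: (Z.mul (Z.mul t.1 s.1) (zsign t.2 s.2), r)])
  else zelt0.

Definition zbracket (u v : zelt) : zelt :=
  foldr zelt_add
    (zzero, [seq (Z.mul (zform u.1 s.2) s.1, s.2) | s <- v.2]
            ++ [seq (Z.opp (Z.mul (zform v.1 t.2) t.1), t.2) | t <- u.2])
    [seq zbracketEE t s | t <- u.2, s <- v.2].

Definition zcoef (p : zvec) (e : seq (Z * zvec)) : Z :=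
  foldr (fun t x => if zeqv t.2 p then Z.add t.1 x else x) 0%zz e.

Definition zelt_is0 (m : zelt) : bool :=
  zeqv m.1 zzero && all (fun t => Z.eqb (zcoef t.2 m.2) 0%zz) m.2.

Definition root_of (a : rootlattice) (ra : is_root a) : E6root := exist _ a ra.

Section IntegralElements.
Variable K : fieldType.
Local Notation E6 := (E6 K).
Local Notation Evec := (Evec K).
Local Notation elt_of := (elt_of K).
Local Notation ofZ := (ofZ K).

Definition root_part (e : seq (Z * zvec)) : E6 := \sum_(t <- e) ofZ t.1 *: Evec (vrow
  t.2).

Lemma elt_ofE m : elt_of m = Hvec (toH K (vrow m.1)) + root_part m.2. Proof. by []. Qed.

Lemma ofZ0 : ofZ 0%zz = 0. Proof. by []. Qed.
Lemma ofZ1 : ofZ 1%zz = 1. Proof. by []. Qed.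

Lemma ofZN1 : ofZ (-1)%zz = -1. Proof. by []. Qed.

Lemma toH0 : toH K (vrow zzero) = 0.
Proof. by rewrite vrow0 /toH map_mx0. Qed.

Lemma Hvec0 : Hvec (0 : 'rV[K]_6) = 0.
Proof. by rewrite -(scale0r (0 : 'rV[K]_6)) HvecZ scale0r. Qed.

Lemma HvecN (h : 'rV[K]_6) : Hvec (- h) = - Hvec h.
Proof. by rewrite -scaleN1r HvecZ scaleN1r. Qed.

Lemma elt_of0 : elt_of zelt0 = 0.
Proof. by rewrite elt_ofE /root_part big_nil toH0 Hvec0 addr0. Qed.

Lemma elt_of_add m n : elt_of (zelt_add m n) = elt_of m + elt_of n.
Proof. by rewrite !elt_ofE /root_part big_cat toH_add HvecD addrACA. Qed.

Lemma elt_of_scale c m : elt_of (zelt_scale c m) = ofZ c *: elt_of m.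
Proof.
rewrite !elt_ofE /root_part toH_scale HvecZ scalerDr scaler_sumr big_map; congr (_ + _).
by apply: eq_bigr => t _; rewrite ofZ_mul scalerA.
Qed.

Lemma elt_of_foldr m0 L : elt_of (foldr zelt_add m0 L) =
  \sum_(m <- L) elt_of m + elt_of m0.
Proof.
elim: L => [|m L IH] /=; first by rewrite big_nil add0r.
by rewrite elt_of_add IH big_cons addrA.
Qed.

Lemma elt_of_H p : elt_of (p, [::]) = Hvec (toH K (vrow p)).
Proof. by rewrite elt_ofE /root_part big_nil addr0. Qed.

Lemma elt_of_E e : elt_of (zzero, e) = root_part e.
Proof. by rewrite elt_ofE toH0 Hvec0 add0r. Qed.

Lemma bracketHE_model p q : zroot q ->
  bracket (Hvec (toH K (vrow p))) (Evec (vrow q)) = ofZ (zform p q) *: Evec (vrow q).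
Proof.
rewrite -is_root_vrow => rq.
by rewrite (bracketHE _ (root_of rq)) /= toH_form.
Qed.

Lemma bracketEH_model p q : zroot q ->
  bracket (Evec (vrow q)) (Hvec (toH K (vrow p))) = - (ofZ (zform p q) *: Evec (vrow q)).
Proof.
rewrite -is_root_vrow => rq.
by rewrite (bracketEH _ (root_of rq)) /= toH_form.
Qed.

Lemma bracketEE_model t s : zroot t.2 -> zroot s.2 ->
  bracket (ofZ t.1 *: Evec (vrow t.2)) (ofZ s.1 *: Evec (vrow s.2))
  = elt_of (zbracketEE t s).
Proof.
case: t s => [c p] [d q] /=; rewrite -!is_root_vrow => rp rq.
rewrite bracketZl bracketZr.
rewrite (bracketEE K (root_of rp) (root_of rq)) /=.
rewrite /zbracketEE /bracketE /= -vrow_add -[X in _ == X]vrow0 vrow_eq.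
case: ifP => _.
  by rewrite elt_of_H toH_scale HvecZ HvecN ofZ_opp ofZ_mul scaleNr !scalerN scalerA.
rewrite is_root_vrow; case: ifP => _; last by rewrite elt_of0 !scaler0.
by rewrite elt_of_E /root_part big_seq1 /= sign_vrow !ofZ_mul !scalerA.
Qed.

(** For p not a root, [Evec p] is 0 while p may still add up with another
    vector to a root; hence the hypotheses. *)
Lemma elt_of_bracket u v : zelt_roots u -> zelt_roots v ->
  bracket (elt_of u) (elt_of v) = elt_of (zbracket u v).
Proof.
case: u v => [hu eu] [hv e'] /allP /= ru /allP /= rv.
rewrite [in LHS]elt_ofE [in X in bracket _ X]elt_ofE /= /zbracket elt_of_foldr
  elt_of_E /=.
rewrite bracketDl !bracketDr bracketHH add0r.
have -> : bracket (Hvec (toH K (vrow hu))) (root_part e')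
   = root_part [seq (Z.mul (zform hu s.2) s.1, s.2) | s <- e'].
  rewrite /root_part bracket_sumr big_map big_seq [RHS]big_seq;
    apply: eq_bigr => s /rv rs.
  by rewrite bracketZr bracketHE_model // scalerA ofZ_mul mulrC.
have -> : bracket (root_part eu) (Hvec (toH K (vrow hv)))
   = root_part [seq (Z.opp (Z.mul (zform hv t.2) t.1), t.2) | t <- eu].
  rewrite /root_part bracket_suml big_map big_seq [RHS]big_seq;
    apply: eq_bigr => s /ru rs.
  by rewrite bracketZl bracketEH_model // scalerN scalerA ofZ_opp ofZ_mul mulrC scaleNr.
rewrite /root_part big_cat /= [RHS]addrC -addrA; congr (_ + (_ + _)).
rewrite big_allpairs_dep bracket_suml big_seq [RHS]big_seq; apply: eq_bigr => t /ru rt.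
rewrite bracket_sumr big_seq [RHS]big_seq; apply: eq_bigr => s /rv rs.
exact: bracketEE_model.
Qed.

Lemma root_part_coef e (b : E6root) : (root_part e).2 b = ofZ (zcoef (zcode (val b)) e).
Proof.
rewrite /root_part; elim: e => [|t e IH] /=; first by rewrite big_nil ffunE.
rewrite big_cons addrC -[_ + _]scale1r -[X in _ *: X]addrC.
rewrite scale1r snd_linear IH ffunE -[X in X == _]zcodeK vrow_eq.
have -> : zeqv (zcode (val b)) t.2 = zeqv t.2 (zcode (val b)).
  by apply/zeqvP/zeqvP.
case: ifP => _; first by rewrite ofZ_add mulr1.
by rewrite mulr0 add0r.
Qed.

Lemma root_part_fst e : (root_part e).1 = 0.
Proof.
rewrite /root_part; elim: e => [|t e IH]; first by rewrite big_nil.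
by rewrite big_cons /= -[RHS]addr0 -[in RHS]IH; congr (_ + _); rewrite scaler0.
Qed.

Lemma zcoef_notin p e : all (fun t => ~~ zeqv t.2 p) e -> zcoef p e = 0%zz.
Proof. by elim: e => //= t e IH /andP[/negPf -> /IH]. Qed.

(** A root that is not listed has coefficient 0, so that the listed ones
    suffice. *)
Lemma elt_of_is0 m : zelt_is0 m -> elt_of m = 0.
Proof.
case: m => [h e] /andP[/zeqvP /= -> /allP z].
rewrite elt_of_E; case E : (root_part e) => [f g].
have -> : f = 0 by rewrite -(root_part_fst e) E.
congr pair; apply/ffunP => b; rewrite ffunE.
have -> : g b = ofZ (zcoef (zcode (val b)) e) by rewrite -root_part_coef E.
have [/hasP[t te /zeqvP tb]|] := boolP (has (fun t => zeqv t.2 (zcode (val b))) e).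
  by rewrite -tb; have /Z.eqb_eq -> := z _ te.
by rewrite -all_predC => /zcoef_notin ->.
Qed.

Lemma elt_of_eq m n : zelt_is0 (zelt_add m (zelt_scale (-1)%zz n)) -> elt_of m = elt_of n.
Proof.
move/elt_of_is0; rewrite elt_of_add elt_of_scale ofZN1 scaleN1r => /eqP.
by rewrite subr_eq0 => /eqP.
Qed.

Lemma sigma_linear (R : pzRingType) (c : R) (a b : 'rV[R]_6) :
  sigma (c *: a + b) = c *: sigma a + sigma b.
Proof.
by apply/rowP => i; rewrite /sigma /cf !mxE; case: i => [[|[|[|[|[|[|//]]]]]] lt] /=.
Qed.

Lemma sigma_hat_linear c (u v : E6) :
  sigma_hat (c *: u + v) = c *: sigma_hat u + sigma_hat v.
Proof.
rewrite /sigma_hat scalerDr -addrACA sigma_linear HvecD HvecZ; congr (_ + _ + _).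
by apply: sum_scale_linear => a; rewrite snd_linear.
Qed.

Lemma sigma_hat0 : sigma_hat (0 : E6) = 0.
Proof.
by have := sigma_hat_linear (-1) 0 0; rewrite scaler0 addr0 scaleN1r addNr.
Qed.
Lemma sigma_hatD (u v : E6) : sigma_hat (u + v) = sigma_hat u + sigma_hat v.
Proof. by rewrite -[u]scale1r sigma_hat_linear !scale1r. Qed.
Lemma sigma_hatZ c (u : E6) : sigma_hat (c *: u) = c *: sigma_hat u.
Proof. by rewrite -[c *: u]addr0 sigma_hat_linear sigma_hat0 addr0. Qed.

Lemma sigma_hatH (h : 'rV[K]_6) : sigma_hat (Hvec h) = Hvec (sigma h).
Proof.
rewrite /sigma_hat big1 ?addr0 // => a _; rewrite [X in X *: _]ffunE; exact: scale0r.
Qed.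

Lemma sigma_hatE (a : E6root) : sigma_hat (Evec (val a)) = Evec (sigma (val a)).
Proof.
rewrite /sigma_hat.
have -> : sigma (Evec (val a)).1 = 0.
  by apply/rowP => i; rewrite /= /sigma /cf !mxE;
     case: i => [[|[|[|[|[|[|//]]]]]] lt].
rewrite Hvec0 add0r.
have E b : (Evec (val a)).2 b = 1 * (Evec (val a)).2 b by rewrite mul1r.
under eq_bigr do rewrite E.
by rewrite (@sum_Evec _ _ a (fun=> 1) (fun b => Evec (sigma (val b)))) scale1r.
Qed.

Lemma toH_sigma p : toH K (vrow (zsigma p)) = sigma (toH K (vrow p)).
Proof.
by rewrite vrow_sigma /toH; apply/rowP => i; rewrite /sigma /cf !mxE;
   case: i => [[|[|[|[|[|[|//]]]]]] lt] /=; rewrite ?mxE.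
Qed.

Lemma elt_of_sigma m : zelt_roots m -> sigma_hat (elt_of m) = elt_of (zelt_sigma m).
Proof.
case: m => [h e] /allP /= r.
rewrite !elt_ofE sigma_hatD sigma_hatH toH_sigma; congr (_ + _).
rewrite /root_part big_map (big_morph _ sigma_hatD sigma_hat0) big_seq [RHS]big_seq.
apply: eq_bigr => t /r; rewrite -is_root_vrow => rt.
by rewrite sigma_hatZ (sigma_hatE (root_of rt)) vrow_sigma.
Qed.

End IntegralElements.

(** * Generators of F4 and the basis of V *)

Definition zbeta : seq zvec :=
  [:: (1, 1, 2, 2, 1, 1); (1, 1, 2, 2, 1, 0); (1, 1, 1, 2, 1, 0);
      (1, 1, 1, 1, 1, 0); (1, 1, 1, 1, 0, 0); (1, 0, 1, 1, 1, 0);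
      (0, 1, 1, 1, 0, 0); (1, 0, 1, 1, 0, 0); (0, 0, 1, 1, 0, 0);
      (1, 0, 1, 0, 0, 0); (0, 0, 1, 0, 0, 0); (1, 0, 0, 0, 0, 0)]%zz.

(** From here on x_1, ..., x_26 have the indices 0, ..., 25; those of x_13 and
    x_14, which have weight zero, are 12 and 13, and x_r and x_(27 - r) have
    indices of sum 25.  The value is meaningful at the other 24 indices. *)
Definition zweight (r : nat) : zvec :=
  if (r < 12)%N then nth zzero zbeta r
  else zscale (-1)%zz (nth zzero zbeta (25 - r)).

Definition zx (r : nat) : zelt :=
  if r == 12 then ((1, 0, 0, 0, 0, -1)%zz, [::])
  else if r == 13 then ((0, 0, 1, 0, -1, 0)%zz, [::])
  else (zzero, [:: (1%zz, zweight r); ((-1)%zz, zsigma (zweight r))]).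

(** Each x_s has a coordinate of E6 in which no other x_r has a component. *)
Definition zcoord (s : nat) (m : zelt) : Z :=
  let: (a1, _, a3, _, _, _) := m.1 in
  if s == 12 then a1 else if s == 13 then a3 else zcoef (zweight s) m.2.

Definition zcomb (l : seq (Z * nat)) : zelt :=
  foldr zelt_add zelt0 [seq zelt_scale t.1 (zx t.2) | t <- l].

Definition zrange : seq Z := [:: -3; -2; -1; 0; 1; 2; 3]%zz.

Definition zroots : seq zvec := Eval vm_compute in
  let box := allpairs pair (allpairs pair (allpairs pair (allpairs pair
    (allpairs pair zrange zrange) zrange) zrange) zrange) zrange in
  filter zroot box.

(** True for at least one root of every orbit of [sigma]. *)
Definition zfirst (p : zvec) : bool :=
  let: (a1, a2, a3, a4, a5, a6) := p in
  Z.ltb a1 a6 || Z.eqb a1 a6 && Z.leb a3 a5.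

(** For a root fixed by [sigma] this is twice the root vector. *)
Definition zgen (p : zvec) : zelt := (zzero, [:: (1%zz, p); (1%zz, zsigma p)]).

Definition cartan_gens : seq zelt :=
  [:: ((0, 1, 0, 0, 0, 0)%zz, [::]); ((0, 0, 0, 1, 0, 0)%zz, [::]);
      ((0, 0, 1, 0, 1, 0)%zz, [::]); ((1, 0, 0, 0, 0, 1)%zz, [::])].

Definition gens : seq zelt :=
  cartan_gens ++ [seq zgen p | p <- zroots & zfirst p].

Definition zact (g : zelt) (r : nat) : seq (Z * nat) :=
  let v := zbracket g (zx r) in
  [seq t <- [seq (zcoord s v, s) | s <- iota 0 26] | ~~ Z.eqb t.1 0%zz].

(** Each generator comes with the 26 images of the x_r, as lists of pairs (c, s)
    that stand for the sum of the c x_s. *)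
Definition table : seq (zelt * seq (seq (Z * nat))) := Eval vm_compute in
  [seq (g, [seq zact g r | r <- iota 0 26]) | g <- gens].

Definition table_ok : bool :=
  all (fun gt => all (fun r => all (fun t => t.2 < 26)%N (nth [::] gt.2 r) &&
    zelt_is0 (zelt_add (zbracket gt.1 (zx r)) (zelt_scale (-1)%zz (zcomb (nth [::]
      gt.2 r)))))
    (iota 0 26)) table.

Lemma table_okP : table_ok. Proof. by vm_compute. Qed.

(** The finite facts behind [gens_in_F4] and [span_in_V]. *)
Definition gens_ok : bool :=
  all (fun g => zelt_roots g && zelt_is0 (zelt_add (zelt_sigma g) (zelt_scale (-1)%zz
    g))) gens
  && all (fun r => [|| r == 12, r == 13 | zroot (zweight r)] && zelt_roots (zx r) &&
    zelt_is0 (zelt_add (zelt_sigma (zx r)) (zx r))) (iota 0 26).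

Lemma gens_okP : gens_ok. Proof. by vm_compute. Qed.

Lemma table_gens : [seq gt.1 | gt <- table] = gens.
Proof. by vm_compute. Qed.

Definition zsq (x : Z) : Z := Z.mul x x.

(** The list of roots is complete.  The search is confined by the identity
    6 (a, a) = 3 (2 a_1 - a_3)^2 + (3 a_3 - 2 a_4)^2 + 3 (2 a_2 - a_4)^2
             + 3 (2 a_6 - a_5)^2 + (3 a_5 - 2 a_4)^2 + a_4^2,
    whose left side is 12 for a root. *)
Definition roots_ok : bool :=
  all (fun a4 =>
  all (fun a3 => if Z.leb (zsq (3 * a3 - 2 * a4)%zz) 12%zz then
  all (fun a5 => if Z.leb (zsq (3 * a5 - 2 * a4)%zz) 12%zz then
  all (fun a2 => if Z.leb (zsq (2 * a2 - a4)%zz) 4%zz then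
  all (fun a1 => if Z.leb (zsq (2 * a1 - a3)%zz) 4%zz then
  all (fun a6 => if Z.leb (zsq (2 * a6 - a5)%zz) 4%zz then
    zroot (a1, a2, a3, a4, a5, a6) ==> has (zeqv (a1, a2, a3, a4, a5, a6)) zroots
  else true) zrange else true) zrange else true) zrange else true) zrange
  else true) zrange) zrange.

Lemma roots_okP : roots_ok. Proof. by vm_compute. Qed.

(** The finite facts behind [xbasis_free], [F4_ind] and [in_V_span]. *)
Definition vectors_ok : bool :=
  all (fun p => (zfirst p || zfirst (zsigma p)) && has (zeqv (zsigma p)) zroots &&
    (let m := (zzero, [:: (1%zz, p); ((-1)%zz, zsigma p)]) in
     zelt_is0 (zelt_add m (zelt_scale (-1)%zz
       (zcomb [seq (zcoord s m, s) | s <- iota 0 26])))) ) zroots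
  && all (fun r => all (fun s => Z.eqb (zcoord s (zx r)) (if s == r then 1%zz else 0%zz))
             (iota 0 26)) (iota 0 26).

Lemma vectors_okP : vectors_ok. Proof. by vm_compute. Qed.

Section F4Module.
Variable K : numFieldType.
Local Notation E6 := (E6 K).
Local Notation Evec := (Evec K).
Local Notation elt_of := (elt_of K).
Local Notation ofZ := (ofZ K).
Local Notation xbasis := (xbasis K).

Lemma ofZ_inj : injective ofZ.
Proof. by move=> a b /intr_inj; apply: (can_inj int_of_ZK). Qed.

Lemma elt_of_pm (p : zvec) : elt_of (zzero, [:: (1%zz, p); ((-1)%zz, zsigma p)])
   = Evec (vrow p) - Evec (vrow (zsigma p)).
Proof. by rewrite elt_of_E /root_part big_cons big_seq1 /= ofZ1 ofZN1 scale1r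
  scaleN1r. Qed.

Lemma elt_of_pp (p : zvec) : elt_of (zgen p) = Evec (vrow p) + Evec (vrow (zsigma p)).
Proof. by rewrite elt_of_E /root_part big_cons big_seq1 /= ofZ1 !scale1r. Qed.

Lemma row6_toH (a1 a2 a3 a4 a5 a6 : Z) :
  toH K (vrow (a1, a2, a3, a4, a5, a6)) =
  row6 (ofZ a1) (ofZ a2) (ofZ a3) (ofZ a4) (ofZ a5) (ofZ a6).
Proof. exact: map_row6. Qed.

Lemma beta_zbeta r : (r < 12)%N -> beta r.+1 = vrow (nth zzero zbeta r).
Proof. by do 12![case: r => [|r] //]. Qed.

Lemma vrowN p : vrow (zscale (-1)%zz p) = - vrow p.
Proof. by rewrite vrow_scale (_ : iz (-1)%zz = -1) ?scaleN1r. Qed.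

Lemma zsigmaN p : zsigma (zscale (-1)%zz p) = zscale (-1)%zz (zsigma p).
Proof. by case: p => [[[[[? ?] ?] ?] ?] ?]. Qed.

Lemma xvecE r : (r < 26)%N -> xvec K r.+1 = elt_of (zx r).
Proof.
move=> r26; rewrite /xvec /zx !eqSS.
have [->|r12] := eqVneq r 12.
  rewrite /= elt_of_H row6_toH; congr (Hvec _); apply/rowP => i.
  by rewrite !mxE -!val_eqE /= !inordK //; case: i => [[|[|[|[|[|[|//]]]]]] lt] /=;
     rewrite ?subr0 ?sub0r ?subrr ?oppr0.
have [->|r13] := eqVneq r 13.
  rewrite /= elt_of_H row6_toH; congr (Hvec _); apply/rowP => i.
  by rewrite !mxE -!val_eqE /= !inordK //; case: i => [[|[|[|[|[|[|//]]]]]] lt] /=;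
     rewrite ?subr0 ?sub0r ?subrr ?oppr0.
rewrite elt_of_pm /zweight; case: ifP => r_lt.
  by rewrite beta_zbeta // -vrow_sigma.
have r14 : (13 < r)%N by case: ltngtP r12 r13 r_lt => //; lia.
have -> : (27 - r.+1 = (25 - r).+1)%N by lia.
rewrite beta_zbeta; last by lia.
by rewrite zsigmaN !vrowN -vrow_sigma.
Qed.

Lemma xbasisE (r : 'I_26) : tnth xbasis r = elt_of (zx r).
Proof. by rewrite tnth_mktuple xvecE. Qed.

Lemma xbasis_nth (r : 'I_26) : xbasis`_r = elt_of (zx r).
Proof. by rewrite -tnth_nth xbasisE. Qed.

Lemma mem_iota26 r : (r < 26)%N -> r \in iota 0 26.
Proof. by move=> r26; rewrite mem_iota add0n. Qed.

Lemma zx_ok r : (r < 26)%N ->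
  [/\ [|| r == 12, r == 13 | zroot (zweight r)], zelt_roots (zx r)
    & sigma_hat (elt_of (zx r)) = - elt_of (zx r)].
Proof.
move=> r26; have /andP[_ /allP /(_ r (mem_iota26 r26))] := gens_okP.
rewrite -andbA => /and3P[rz rm /(elt_of_is0 K) z]; split=> //.
by rewrite elt_of_sigma //; apply/eqP; rewrite -addr_eq0 -elt_of_add z.
Qed.

Definition xcoord (s : nat) (v : E6) : K :=
  if s == 12 then cf v.1 1 else if s == 13 then cf v.1 3 else
  if insub (vrow (zweight s)) is Some b then v.2 b else 0.

Lemma xcoord_linear s c (u v : E6) : xcoord s (c *: u + v) = c * xcoord s u + xcoord s v.
Proof.
rewrite /xcoord; case: ifP => _; first by rewrite /cf !mxE.
case: ifP => _; first by rewrite /cf !mxE.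
by case: insubP => [b _ _|_]; rewrite ?snd_linear // mulr0 addr0.
Qed.

Lemma elt_of_fst m : (elt_of m).1 = toH K (vrow m.1).
Proof. by rewrite elt_ofE /= root_part_fst addr0. Qed.

Lemma elt_of_snd m (b : E6root) : (elt_of m).2 b = ofZ (zcoef (zcode (val b)) m.2).
Proof.
rewrite elt_ofE addrC -[root_part _ _]scale1r snd_linear mul1r root_part_coef.
by rewrite [X in _ + X]ffunE addr0.
Qed.

Lemma xcoord_elt_of s m : (s < 26)%N -> xcoord s (elt_of m) = ofZ (zcoord s m).
Proof.
case/zx_ok => rz _ _; rewrite /xcoord /zcoord elt_of_fst.
case E : m.1 => [[[[[a1 a2] a3] a4] a5] a6].
case: ifP rz => [_ _|_ rz]; first by rewrite row6_toH cf_row6.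
case: ifP rz => [_ _|_]; first by rewrite row6_toH cf_row6.
by rewrite -is_root_vrow => rz; rewrite insubT elt_of_snd SubK vrowK.
Qed.

Lemma xcoord_zx s r : (s < 26)%N -> (r < 26)%N -> xcoord s (elt_of (zx r)) = (s == r)%:R.
Proof.
move=> s26 r26; rewrite xcoord_elt_of //; have /andP[_ /allP /(_ r (mem_iota26 r26))]
  := vectors_okP.
move=> /allP /(_ s (mem_iota26 s26)) /Z.eqb_eq ->.
by case: eqP.
Qed.

Lemma xcoord0 s : xcoord s 0 = 0.
Proof. by have := xcoord_linear s (-1) 0 0; rewrite scaler0 addr0 mulN1r addNr. Qed.

Lemma xcoordD s u v : xcoord s (u + v) = xcoord s u + xcoord s v.
Proof. by rewrite -[u]scale1r xcoord_linear mul1r scale1r. Qed.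

Lemma xcoordZ s c u : xcoord s (c *: u) = c * xcoord s u.
Proof. by rewrite -[c *: u]addr0 xcoord_linear xcoord0 addr0. Qed.

Lemma xbasis_free : free xbasis.
Proof.
apply/freeP => k sum0 i.
have := xcoord0 i; rewrite -sum0 (big_morph _ (xcoordD i) (xcoord0 i)).
rewrite (bigD1 i) //= xcoordZ xbasis_nth xcoord_zx // eqxx mulr1 big1 ?addr0 // => j ne.
by rewrite xcoordZ xbasis_nth xcoord_zx // (negPf (_ : _ != _ :> nat)) ?mulr0 // eq_sym.
Qed.

Lemma xbasis_span r : (r < 26)%N -> elt_of (zx r) \in <<xbasis>>%VS.
Proof.
move=> r26; rewrite -(xbasis_nth (Ordinal r26)).
by apply/memv_span/mem_nth; rewrite size_tuple.
Qed.

Lemma elt_of_comb l : elt_of (zcomb l) = \sum_(t <- l) ofZ t.1 *: elt_of (zx t.2).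
Proof.
rewrite /zcomb elt_of_foldr elt_of0 addr0 big_map.
by apply: eq_bigr => t _; rewrite elt_of_scale.
Qed.

Lemma comb_span l : all (fun t => t.2 < 26)%N l -> elt_of (zcomb l) \in <<xbasis>>%VS.
Proof.
move=> /allP l26; rewrite elt_of_comb big_seq; apply: memv_suml => t /l26 t26.
exact/memvZ/xbasis_span.
Qed.

(** The terms on the right of the identity for [roots_ok] are nonnegative, so that
    none exceeds 12. *)
Lemma root_cases (a : E6root) : exists2 p, val a = vrow p & p \in zroots.
Proof.
exists (zcode (val a)); first by rewrite zcodeK.
have rt : zroot (zcode (val a)) by rewrite -is_root_vrow zcodeK (valP a).
have bnd i : Z_of_int (cf (val a) i) \in zrange.
  have := root_bound (inord i.-1) (valP a); rewrite -/(cf _ i).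
  case: (cf (val a) i) => [[|[|[|[|n]]]]|[|[|[|n]]]] //=; lia.
have := roots_okP; move: rt; rewrite /zcode.
move: (bnd 1%N) (bnd 2%N) (bnd 3%N) (bnd 4%N) (bnd 5%N) (bnd 6%N).
move: (Z_of_int (cf (val a) 1)) (Z_of_int (cf (val a) 2)) (Z_of_int (cf (val a) 3))
  (Z_of_int (cf (val a) 4)) (Z_of_int (cf (val a) 5)) (Z_of_int (cf (val a) 6)).
move=> a1 a2 a3 a4 a5 a6 b1 b2 b3 b4 b5 b6 rt.
have sq : (3 * zsq (2 * a1 - a3) + zsq (3 * a3 - 2 * a4) + 3 * zsq (2 * a2 - a4)
    + 3 * zsq (2 * a6 - a5) + zsq (3 * a5 - 2 * a4) + zsq a4 = 12)%zz.
  by move: rt => /Z.eqb_eq; rewrite /zform /zsq; lia.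
have ge0 x : (0 <= zsq x)%zz by exact: Z.square_nonneg.
move: (ge0 (2 * a1 - a3)%zz) (ge0 (3 * a3 - 2 * a4)%zz) (ge0 (2 * a2 - a4)%zz)
  (ge0 (2 * a6 - a5)%zz) (ge0 (3 * a5 - 2 * a4)%zz) (ge0 a4) sq => {ge0}.
have sum_le q1 q2 q3 q4 q5 q6 : (0 <= q1 -> 0 <= q2 -> 0 <= q3 -> 0 <= q4 ->
    0 <= q5 -> 0 <= q6 -> 3 * q1 + q2 + 3 * q3 + 3 * q4 + q5 + q6 = 12 ->
    [&& Z.leb q1 4, Z.leb q2 12, Z.leb q3 4, Z.leb q4 4 & Z.leb q5 12])%zz.
  by clear; move=> *; apply/and5P; split; apply/Z.leb_le; lia.
move=> g1 g2 g3 g4 g5 g6 sq.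
have /and5P[l1 l2 l3 l4 l5] := sum_le _ _ _ _ _ _ g1 g2 g3 g4 g5 g6 sq.
move=> /allP /(_ _ b4) /allP /(_ _ b3); rewrite l2.
move=> /allP /(_ _ b5); rewrite l5 => /allP /(_ _ b2); rewrite l3.
move=> /allP /(_ _ b1); rewrite l1 => /allP /(_ _ b6); rewrite l4.
by rewrite rt => /hasP[p' p'in /zeqvP ->].
Qed.

Lemma E6_decomp (u : E6) :
  u = Hvec u.1 + \sum_(a : E6root) u.2 a *: Evec (val a).
Proof.
case: u => h g /=; congr pair.
  rewrite [X in _ + X](_ : _ = 0) ?addr0 //.
  by apply: (big_ind (fun x : E6 => x.1 = 0)) => [|x y /= -> ->|a _] //=;
     rewrite ?addr0 ?scaler0.
apply/ffunP => b; rewrite [RHS]ffunE [X in X + _]ffunE add0r.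
rewrite (big_morph (fun x : E6 => x.2 b) (id1 := 0) (op1 := +%R)); last 2 first.
- by move=> x y; rewrite -[x]scale1r snd_linear mul1r scale1r.
- by rewrite ffunE.
have E a : (g a *: Evec (val a)).2 b = g a * (b == a)%:R.
  rewrite -[g a *: _]addr0 snd_linear ffunE (inj_eq val_inj).
  by rewrite [X in _ + X]ffunE addr0.
rewrite (eq_bigr _ (fun a _ => E a)) (bigD1 b) //= eqxx mulr1 big1 ?addr0 // => a.
by rewrite eq_sym => /negPf ->; rewrite mulr0.
Qed.

Lemma sigma_hat_decomp (u : E6) : sigma_hat u =
  Hvec (sigma u.1) + \sum_(a : E6root) u.2 a *: Evec (sigma (val a)).
Proof. by []. Qed.

Lemma half_add (V : lmodType K) (u : V) : u = 2^-1 *: (u + u).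
Proof. by rewrite -mulr2n -scaler_nat scalerA mulVf ?scale1r ?pnatr_eq0. Qed.

Lemma add_sigma_cartan (h : 'rV[K]_6) : h + sigma h =
  (2 * cf h 2) *: toH K (vrow (0, 1, 0, 0, 0, 0)%zz)
  + (2 * cf h 4) *: toH K (vrow (0, 0, 0, 1, 0, 0)%zz)
  + (cf h 3 + cf h 5) *: toH K (vrow (0, 0, 1, 0, 1, 0)%zz)
  + (cf h 1 + cf h 6) *: toH K (vrow (1, 0, 0, 0, 0, 1)%zz).
Proof.
rewrite {1}[h]row6_cf /sigma !row6_toH; apply/rowP => i; rewrite !mxE.
by case: i => [[|[|[|[|[|[|//]]]]]] lt] /=; rewrite ?ofZ0 ?ofZ1; ring.
Qed.

Lemma sub_sigma_cartan (h : 'rV[K]_6) : h - sigma h =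
  (cf h 1 - cf h 6) *: toH K (vrow (1, 0, 0, 0, 0, -1)%zz)
  + (cf h 3 - cf h 5) *: toH K (vrow (0, 0, 1, 0, -1, 0)%zz).
Proof.
rewrite {1}[h]row6_cf /sigma !row6_toH; apply/rowP => i; rewrite !mxE.
by case: i => [[|[|[|[|[|[|//]]]]]] lt] /=; rewrite ?ofZ0 ?ofZ1 ?ofZN1; ring.
Qed.

Lemma gens_mem p : p \in zroots -> zfirst p -> zgen p \in gens.
Proof.
move=> pin pf; rewrite /gens mem_cat; apply/orP; right.
by apply: map_f; rewrite mem_filter pf.
Qed.

Lemma cartan_gens_mem i : (i < 4)%N -> nth zelt0 cartan_gens i \in gens.
Proof. by move=> i4; rewrite /gens mem_cat mem_nth. Qed.

(** An element u fixed by the automorphism is half of u + sigma_hat u, which is a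
    combination of the h + sigma h and of the E_p + E_sigma(p). *)
Lemma F4_ind (P : E6 -> Prop) :
  P 0 -> (forall c u v, P u -> P v -> P (c *: u + v)) ->
  (forall g, g \in gens -> P (elt_of g)) -> forall u, in_F4 u -> P u.
Proof.
move=> P0 PL Pg u Fu.
have PZ c v : P v -> P (c *: v) by move=> Pv; rewrite -[_ *: _]addr0; apply: PL.
have PD v w : P v -> P w -> P (v + w).
  by move=> Pv Pw; rewrite -[v]scale1r; apply: PL.
have Psum (I : Type) (r : seq I) (F : I -> E6) : (forall i, P (F i)) ->
  P (\sum_(i <- r) F i).
  by move=> PF; apply: big_ind.
rewrite [u]half_add -{2}Fu; apply: (PZ).
rewrite {1}[u]E6_decomp sigma_hat_decomp addrACA -HvecD add_sigma_cartan -big_split.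
apply: (PD).
  rewrite !HvecD !HvecZ -!elt_of_H.
  have PC c g : g \in gens -> P (c *: elt_of g) by move=> gg; apply/PZ/Pg.
  exact: (PD _ _ (PD _ _ (PD _ _
    (PC _ _ (@cartan_gens_mem 0 isT)) (PC _ _ (@cartan_gens_mem 1 isT)))
    (PC _ _ (@cartan_gens_mem 2 isT))) (PC _ _ (@cartan_gens_mem 3 isT))).
apply: Psum => a; rewrite /= -scalerDr; apply: (PZ).
have [p] := root_cases a; rewrite /= => -> pin; rewrite -vrow_sigma.
have /andP[/allP /(_ p pin) /andP[/andP[pf spin] _] _] := vectors_okP.
case/orP: pf => pf; first by rewrite -elt_of_pp; apply/Pg/gens_mem.
have {}spin : zsigma p \in zroots by case/hasP: spin => q qin /zeqvP ->.
rewrite addrC [X in _ + Evec (vrow X)](_ : p = zsigma (zsigma p)); last first.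
  by case: (p) => [[[[[? ?] ?] ?] ?] ?].
rewrite -elt_of_pp; exact/Pg/gens_mem.
Qed.

(** Likewise w in V is half of w - sigma_hat w. *)
Lemma in_V_span (w : E6) : in_V w -> w \in <<xbasis>>%VS.
Proof.
move=> Vw; rewrite [w]half_add -{2}[w]opprK -Vw; apply: memvZ.
rewrite {1}[w]E6_decomp sigma_hat_decomp opprD addrACA -HvecN -HvecD sub_sigma_cartan
  -sumrB.
apply: memvD.
  rewrite HvecD !HvecZ -!elt_of_H; apply: memvD; apply: memvZ.
    exact: (@xbasis_span 12).
  exact: (@xbasis_span 13).
apply: memv_suml => a _; rewrite -scalerBr; apply: memvZ.
have [p -> pin] := root_cases a; rewrite -vrow_sigma -elt_of_pm.
have /andP[/allP /(_ p pin) /andP[_ /(elt_of_eq K) ->] _] := vectors_okP.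
apply: comb_span; apply/allP => t /mapP[s]; rewrite mem_iota => /andP[_ s26] -> /=.
by rewrite add0n in s26.
Qed.

Lemma span_in_V (w : E6) : w \in <<xbasis>>%VS -> in_V w.
Proof.
move=> /coord_span ->; rewrite /in_V (big_morph _ (@sigma_hatD K) (sigma_hat0 K)).
rewrite -sumrN; apply: eq_bigr => i _; rewrite sigma_hatZ xbasis_nth.
by have [_ _ ->] := zx_ok (ltn_ord i); rewrite scalerN.
Qed.

Lemma gens_in_F4 g : g \in gens -> in_F4 (elt_of g).
Proof.
move=> gg; have /andP[/allP /(_ g gg) /andP[rg /(elt_of_eq K) z] _] := gens_okP.
by rewrite /in_F4 elt_of_sigma.
Qed.

End F4Module.

(** * The action on polynomials *)

(** Identities between algebra morphisms, or between derivations, need to be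
    verified on the variables only. *)
Lemma mpoly_alg_ind (R : comNzRingType) n (P : {mpoly R[n]} -> Prop) :
  P 1 -> (forall i, P 'X_i) ->
  (forall c p q, P p -> P q -> P (c *: p + q)) ->
  (forall p q, P p -> P q -> P (p * q)) -> forall p, P p.
Proof.
move=> P1 PX PL PM p.
have P0 : P 0 by have := PL (-1) 1 1 P1 P1; rewrite scaleN1r addNr.
elim/mpolyind: p => // c m p _ _; apply: PL.
rewrite mpolyXE_id; apply: big_ind => // i _.
by elim: (m i) => [|k IH]; rewrite ?expr0 // exprS; apply: PM.
Qed.

Section Action.
Variable K : numFieldType.
Local Notation E6 := (E6 K).
Local Notation elt_of := (elt_of K).
Local Notation ofZ := (ofZ K).
Local Notation xbasis := (xbasis K).
Local Notation A := {mpoly K[26]}.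

Definition X (i : nat) : A := 'X_(inord i).

Definition linform (l : seq (Z * nat)) : A := \sum_(t <- l) ofZ t.1 *: X t.2.

Lemma linpoly_linear c (u v : E6) :
  linpoly (c *: u + v) = c *: linpoly u + linpoly v.
Proof.
rewrite /linpoly scaler_sumr -big_split; apply: eq_bigr => i _ /=.
by rewrite linearP scalerDl scalerA.
Qed.

Lemma linpoly0 : linpoly (0 : E6) = 0.
Proof.
by have := linpoly_linear (-1) 0 0; rewrite scaler0 addr0 scaleN1r addNr.
Qed.
Lemma linpolyD u v : linpoly (u + v : E6) = linpoly u + linpoly v.
Proof. by rewrite -[u]scale1r linpoly_linear !scale1r. Qed.
Lemma linpolyZ c u : linpoly (c *: u : E6) = c *: linpoly u.
Proof. by rewrite -[c *: u]addr0 linpoly_linear linpoly0 addr0. Qed.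

Lemma coord_zx (r : nat) (j : 'I_26) : (r < 26)%N ->
  coord xbasis j (elt_of (zx r)) = (r == j)%:R.
Proof.
move=> r26; rewrite -(xbasis_nth K (Ordinal r26)) coord_free ?xbasis_free //.
Qed.

Lemma linpoly_zx r : (r < 26)%N -> linpoly (elt_of (zx r)) = X r.
Proof.
move=> r26; rewrite /linpoly (bigD1 (Ordinal r26)) //= coord_zx // eqxx scale1r.
rewrite big1 ?addr0 => [|j ne]; first by congr 'X_ _; apply: val_inj; rewrite /= inordK.
by rewrite coord_zx // eq_sym (negPf (_ : _ != _ :> nat)) ?scale0r.
Qed.

Lemma linpoly_comb l : all (fun t => t.2 < 26)%N l -> linpoly (elt_of (zcomb l)) =
  linform l.
Proof.
move=> /allP l26; rewrite elt_of_comb (big_morph _ linpolyD linpoly0) /linform.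
rewrite big_seq [RHS]big_seq; apply: eq_bigr => t /l26 t26.
by rewrite linpolyZ linpoly_zx.
Qed.

Lemma F4_act_linear_l c (u v : E6) f :
  F4_act (c *: u + v) f = c *: F4_act u f + F4_act v f.
Proof.
rewrite /F4_act scaler_sumr -big_split; apply: eq_bigr => i _ /=.
by rewrite bracket_linear_l linpoly_linear mulrDl scalerAl.
Qed.

Lemma F4_act0l f : F4_act (0 : E6) f = 0.
Proof.
by have := F4_act_linear_l (-1) 0 0 f; rewrite scaler0 addr0 scaleN1r addNr.
Qed.

Lemma F4_act_linear_r (u : E6) c f g :
  F4_act u (c *: f + g) = c *: F4_act u f + F4_act u g.
Proof.
rewrite /F4_act scaler_sumr -big_split; apply: eq_bigr => i _ /=.
by rewrite mderivD mderivZ mulrDr scalerAr.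
Qed.

Lemma F4_actM (u : E6) f g : F4_act u (f * g) = F4_act u f * g + f * F4_act u g.
Proof.
rewrite /F4_act mulr_suml mulr_sumr -big_split; apply: eq_bigr => i _ /=.
by rewrite mderivM; ring.
Qed.

Lemma F4_act1 (u : E6) : F4_act u 1 = 0.
Proof.
by apply: big1 => i _; rewrite -(mpolyC1 26 K) mderivC mulr0.
Qed.

Lemma mderiv_X (R : comNzRingType) n (i j : 'I_n) :
  ('X_i : {mpoly R[n]})^`M(j) = (i == j)%:R.
Proof.
rewrite mderivX mnm1E; case: eqP => [->|_]; last by rewrite scale0r.
by rewrite scale1r -[X in (X - _)%MM]add0m addmK mpolyX0.
Qed.

Lemma table_bracket gt r : gt \in table -> (r < 26)%N ->
  bracket (elt_of gt.1) (elt_of (zx r)) = elt_of (zcomb (nth [::] gt.2 r))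
  /\ all (fun t => t.2 < 26)%N (nth [::] gt.2 r).
Proof.
move=> gin r26.
have /allP/(_ _ gin)/allP/(_ r (mem_iota26 r26))/andP[l26 /(elt_of_eq K) E] := table_okP.
split=> //; rewrite -E elt_of_bracket //; last by have [] := zx_ok K r26.
have gg : gt.1 \in gens by rewrite -table_gens map_f.
by have /andP[/allP/(_ _ gg)/andP[]] := gens_okP.
Qed.

(** The derivation that extends the linear map with the given rows. *)
Definition table_act (t : seq (seq (Z * nat))) (f : A) : A :=
  \sum_(r < 26) linform (nth [::] t r) * f^`M(r).

Lemma F4_act_table gt f : gt \in table -> F4_act (elt_of gt.1) f = table_act gt.2 f.
Proof.
move=> gin; apply: eq_bigr => r _; rewrite xbasisE.
by have [-> l26] := table_bracket gin (ltn_ord r); rewrite linpoly_comb.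
Qed.

Lemma F4_table_ind (P : E6 -> Prop) :
  P 0 -> (forall c u v, P u -> P v -> P (c *: u + v)) ->
  (forall gt, gt \in table -> P (elt_of gt.1)) -> forall u, in_F4 u -> P u.
Proof.
move=> P0 PL Pt; apply: F4_ind => // g; rewrite -table_gens => /mapP[gt gin ->].
exact: Pt.
Qed.

Lemma F4_invariantP f :
  F4_invariant f <-> forall gt, gt \in table -> table_act gt.2 f = 0.
Proof.
split=> [inv gt gin|z].
  rewrite -F4_act_table //; apply/inv/gens_in_F4.
  by rewrite -table_gens map_f.
apply: F4_table_ind => [|c u v zu zv|gt gin]; first exact: F4_act0l.
  by rewrite F4_act_linear_l zu zv scaler0 addr0.
by rewrite F4_act_table // z.
Qed.

End Action.

(** * Integral polynomials *)

(** A monomial is the list of its variables, with repetitions. *)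
Definition zpol : Type := seq (Z * seq nat).

(** The Leibniz rule. *)
Fixpoint zderiv_mon (tab : seq (seq (Z * nat))) (m : seq nat) : zpol :=
  if m is i :: m' then
    [seq (t.1, t.2 :: m') | t <- nth [::] tab i]
    ++ [seq (t.1, i :: t.2) | t <- zderiv_mon tab m']
  else [::].

Definition zpol_scale (c : Z) (p : zpol) : zpol := [seq (Z.mul c t.1, t.2) | t <- p].

Definition zderiv (tab : seq (seq (Z * nat))) (p : zpol) : zpol :=
  flatten [seq zpol_scale t.1 (zderiv_mon tab t.2) | t <- p].

Fixpoint mon_insert_var (i : nat) (m : seq nat) : seq nat :=
  if m is j :: m' then if (i <= j)%N then i :: m else j :: mon_insert_var i m'
  else [:: i].

Definition mon_sort_vars (m : seq nat) : seq nat := foldr mon_insert_var [::] m.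

Fixpoint zpol_insert (c : Z) (m : seq nat) (p : zpol) : zpol :=
  if p is (d, n) :: q then
    if n == m then (Z.add c d, n) :: q else (d, n) :: zpol_insert c m q
  else [:: (c, m)].

Definition zpol_norm (p : zpol) : zpol :=
  [seq t <- foldr (fun t => zpol_insert t.1 (mon_sort_vars t.2)) [::] p | ~~ Z.eqb
    t.1 0%zz].

Definition zpol_mulX (i : nat) (p : zpol) : zpol := [seq (t.1, i :: t.2) | t <- p].

Definition zpol_wf (p : zpol) : bool := all (fun t => all (fun i => i < 26)%N t.2) p.

Definition zeta1_pol : zpol :=
  [:: (2%zz, [:: 0; 12]); (1%zz, [:: 0; 13]); ((-3)%zz, [:: 1; 11]);
      ((-3)%zz, [:: 2; 9]); (3%zz, [:: 3; 7]); ((-3)%zz, [:: 4; 5])].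

Definition chain_step (s : nat) : seq (nat * nat * Z) :=
  [seq (rk, c) | rk <- [seq (r, k) | r <- iota 0 s, k <- iota 0 (size table)],
     c <- [seq c <- [:: 1; -1]%zz |
            nth [::] (nth (zelt0, [::]) table rk.2).2 rk.1 == [:: (c, s)]]].

(** The entry of index s - 1 is a triple (r, k, c) such that r < s, that c is 1 or
    -1, and that the generator of index k maps x_r to c x_s, in terms of indices
    from 0.  So V is generated by x_1. *)
Definition chain : seq (nat * nat * Z) := Eval vm_compute in
  [seq head (0, 0, 0%zz) (chain_step s) | s <- iota 1 25].

(** Equivariance leaves no choice: zeta_s is the image of c zeta_r. *)
Definition zetas : seq zpol := Eval vm_compute in
  foldl (fun zs rkc => let: (r, k, c) := rkc in
    rcons zs (zpol_norm (zpol_scale c (zderiv (nth (zelt0,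
      [::]) table k).2 (nth [::] zs r)))))
    [:: zeta1_pol] chain.

Definition eta1_pol : zpol :=
  [seq (3%zz, [:: r; (25 - r)%N]) | r <- iota 0 12]
  ++ [:: ((-1)%zz, [:: 12; 12]); ((-1)%zz, [:: 12; 13]); ((-1)%zz, [:: 13; 13])].

Definition zeta_pol (r : nat) : zpol := nth [::] zetas r.

Definition eta2_raw : zpol :=
  flatten [seq zpol_scale 3%zz (zpol_mulX (25 - r)%N (zeta_pol r) ++
    zpol_mulX r (zeta_pol (25 - r)%N))
          | r <- iota 0 12]
  ++ zpol_scale (-2)%zz (zpol_mulX 12 (zeta_pol 12)) ++
    zpol_scale (-1)%zz (zpol_mulX 12 (zeta_pol 13))
  ++ zpol_scale (-1)%zz (zpol_mulX 13 (zeta_pol 12)) ++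
    zpol_scale (-2)%zz (zpol_mulX 13 (zeta_pol 13)).

Definition eta2_pol : zpol := Eval vm_compute in zpol_norm eta2_raw.

Definition chain_ok : bool :=
  all (fun s => let: (r, k, c) := nth (0, 0, 0%zz) chain s.-1 in
    [&& (r < s)%N, (k < size table)%N, nth [::] (nth (zelt0,
      [::]) table k).2 r == [:: (c, s)]
      & Z.eqb (Z.mul c c) 1%zz]) (iota 1 25).

Lemma chain_okP : chain_ok. Proof. by vm_compute. Qed.

(** This amounts to the equivariance of the family under the generators. *)
Definition zetas_ok : bool :=
  all zpol_wf zetas &&
  all (fun gt => all (fun r =>
    zpol_norm (zderiv gt.2 (zeta_pol r)
           ++ flatten [seq zpol_scale (Z.opp t.1) (zeta_pol t.2) | t <- nth [::] gt.2 r])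
    == [::]) (iota 0 26)) table.

Lemma zetas_okP : zetas_ok. Proof. by vm_compute. Qed.

Definition etas_ok : bool :=
  all (fun gt => (zpol_norm (zderiv gt.2 eta1_pol) == [::]) &&
    (zpol_norm (zderiv gt.2 eta2_pol) == [::]))
    table && zpol_wf eta1_pol && zpol_wf eta2_pol.

Lemma etas_okP : etas_ok. Proof. by vm_compute. Qed.

(** When these variables are set to 1 and the others to 0, zeta_s is the only
    member of the family that does not vanish.  The weights of the zeta_r other
    than zeta_13 and zeta_14 are distinct, so a product of two variables occurs
    in one of them at most; zeta_13 is singled out by the square of x_13, and
    zeta_14 by a product that does not occur in zeta_13. *)
Definition zeta_witness (s : nat) : seq nat :=
  if s == 12 then [:: 12] else
  head [::] [seq t.2 | t <- zeta_pol s &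
      (12 \notin t.2) && (13 \notin t.2)
      && (t.2 \notin [seq u.2 | u <- zeta_pol 12])].

Definition zindicator (m : seq nat) (i : nat) : Z := if i \in m then 1%zz else 0%zz.

Definition zpol_eval (v : nat -> Z) (p : zpol) : Z :=
  foldr (fun t x => Z.add (Z.mul t.1 (foldr (fun i y =>
    Z.mul (v i) y) 1%zz t.2)) x) 0%zz p.

Definition zetas_indep : bool :=
  all (fun s => all (fun r =>
    Z.eqb (zpol_eval (zindicator (zeta_witness s)) (zeta_pol r)) 0%zz == (r != s))
      (iota 0 26))
  (iota 0 26).

Lemma zetas_indepP : zetas_indep. Proof. by vm_compute. Qed.

Section IntegralPolynomials.
Variable K : numFieldType.
Local Notation ofZ := (ofZ K).
Local Notation A := {mpoly K[26]}.
Local Notation X := (X K).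
Local Notation linform := (linform K).

Definition monomial (m : seq nat) : A := \prod_(i <- m) X i.
Definition pol_of (p : zpol) : A := \sum_(t <- p) ofZ t.1 *: monomial t.2.

Lemma monomial_cons i m : monomial (i :: m) = X i * monomial m.
Proof. by rewrite /monomial big_cons. Qed.

Lemma pol_of_nil : pol_of [::] = 0. Proof. by rewrite /pol_of big_nil. Qed.

Lemma pol_of_cons t p : pol_of (t :: p) = ofZ t.1 *: monomial t.2 + pol_of p.
Proof. by rewrite /pol_of big_cons. Qed.

Lemma pol_of_cat p q : pol_of (p ++ q) = pol_of p + pol_of q.
Proof. by rewrite /pol_of big_cat. Qed.

Lemma pol_of_flatten ps : pol_of (flatten ps) = \sum_(p <- ps) pol_of p.
Proof.
by elim: ps => [|p ps IH] /=; rewrite ?big_nil ?pol_of_nil // big_cons pol_of_cat IH.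
Qed.

Lemma pol_of_scale c p : pol_of (zpol_scale c p) = ofZ c *: pol_of p.
Proof.
rewrite /pol_of big_map scaler_sumr; apply: eq_bigr => t _.
by rewrite ofZ_mul scalerA.
Qed.

Lemma pol_of_mulX i p : pol_of (zpol_mulX i p) = X i * pol_of p.
Proof.
rewrite /pol_of big_map mulr_sumr; apply: eq_bigr => t _.
by rewrite monomial_cons scalerAr.
Qed.

Lemma monomial_insert i m : monomial (mon_insert_var i m) = X i * monomial m.
Proof.
elim: m => [|j m IH] /=; first exact: monomial_cons.
by case: ifP => _; rewrite !monomial_cons ?IH // mulrCA.
Qed.

Lemma monomial_sort m : monomial (mon_sort_vars m) = monomial m.
Proof. by elim: m => //= i m IH; rewrite monomial_insert IH monomial_cons. Qed.

Lemma pol_of_insert c m p : pol_of (zpol_insert c m p) = ofZ c *: monomial m + pol_of p.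
Proof.
elim: p => [|[d n] p IH] /=; first by rewrite pol_of_cons.
case: eqP => [->|_]; rewrite !pol_of_cons /= ?IH; last exact: addrCA.
by rewrite ofZ_add scalerDl addrA.
Qed.

Lemma pol_of_norm p : pol_of (zpol_norm p) = pol_of p.
Proof.
rewrite /zpol_norm; set q := foldr _ _ _.
have -> : pol_of [seq t <- q | ~~ Z.eqb t.1 0%zz] = pol_of q.
  elim: q => //= t q IH; case: ifP => [_|/negbFE/Z.eqb_eq z]; rewrite !pol_of_cons IH //.
  by rewrite z ofZ0 scale0r add0r.
by rewrite {}/q; elim: p => //= t p IH; rewrite pol_of_insert IH pol_of_cons
  monomial_sort.
Qed.

Lemma pol_of_eq0 p : zpol_norm p == [::] -> pol_of p = 0.
Proof. by rewrite -pol_of_norm => /eqP ->; exact: pol_of_nil. Qed.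

Lemma ofZ_scale c (p : A) : ofZ c *: p = (iz c)%:~R * p.
Proof. by rewrite /ofZ scaler_int mulrzl. Qed.

Lemma iz_small : ((iz 1%zz = 1) * (iz 2%zz = 2) * (iz 3%zz = 3)
  * (iz (-1)%zz = -1) * (iz (-2)%zz = -2) * (iz (-3)%zz = -3))%type.
Proof. by []. Qed.

Lemma table_act_linear tab c f g : table_act tab (c *: f + g) =
  c *: table_act tab f + table_act tab g :> A.
Proof.
rewrite /table_act scaler_sumr -big_split; apply: eq_bigr => i _ /=.
by rewrite mderivD mderivZ mulrDr scalerAr.
Qed.

Lemma table_act0 tab : table_act tab 0 = 0 :> A.
Proof.
by have := table_act_linear tab (-1) 0 0; rewrite scaler0 addr0 scaleN1r addNr.
Qed.
Lemma table_actD tab f g : table_act tab (f + g) = table_act tab f + table_act tab g :> A.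
Proof. by rewrite -[f]scale1r table_act_linear !scale1r. Qed.
Lemma table_actZ tab c f : table_act tab (c *: f) = c *: table_act tab f :> A.
Proof. by rewrite -[c *: f]addr0 table_act_linear table_act0 addr0. Qed.

Lemma table_actM tab f g : table_act tab (f * g) =
  table_act tab f * g + f * table_act tab g :> A.
Proof.
rewrite /table_act mulr_suml mulr_sumr -big_split; apply: eq_bigr => i _ /=.
by rewrite mderivM; ring.
Qed.

Lemma table_act1 tab : table_act tab 1 = 0 :> A.
Proof. by apply: big1 => i _; rewrite -(mpolyC1 26 K) mderivC mulr0. Qed.

Lemma table_actX tab i : (i < 26)%N -> table_act tab (X i) = linform (nth [::] tab i).
Proof.
move=> i26; rewrite /table_act (bigD1 (Ordinal i26)) //= big1 => [|j ne].
  rewrite addr0 mderiv_X -val_eqE /= inordK // eqxx; exact: mulr1.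
by rewrite mderiv_X -val_eqE /= inordK // eq_sym (negPf (_ : _ != _ :> nat)) ?mulr0.
Qed.

Lemma table_act_monomial tab m : all (fun i => i < 26)%N m ->
  table_act tab (monomial m) = pol_of (zderiv_mon tab m).
Proof.
elim: m => [_|i m IH /andP[i26 /IH E]].
  by rewrite pol_of_nil /monomial big_nil table_act1.
rewrite monomial_cons table_actM table_actX // E pol_of_cat /linform /pol_of !big_map
  mulr_suml mulr_sumr.
congr (_ + _); apply: eq_bigr => t _; rewrite monomial_cons.
  by rewrite scalerAl.
by rewrite scalerAr.
Qed.

(** Reduces every verification of invariance to an evaluation. *)
Lemma table_act_pol_of tab p : zpol_wf p -> table_act tab (pol_of p) =
  pol_of (zderiv tab p).
Proof.
rewrite /zderiv pol_of_flatten big_map; elim: p => [_|t p IH /andP[t26 /IH E]].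
  by rewrite pol_of_nil table_act0 big_nil.
by rewrite pol_of_cons table_actD table_actZ table_act_monomial // E big_cons
  pol_of_scale.
Qed.

Lemma zpol_evalP (v : nat -> Z) p : zpol_wf p ->
  (pol_of p).@[fun i => ofZ (v i)] = ofZ (zpol_eval v p).
Proof.
elim: p => [|t p IH] /=; first by rewrite pol_of_nil meval0.
move=> /andP[t26 /IH E]; rewrite pol_of_cons mevalD mevalZ E ofZ_add ofZ_mul.
congr (_ * _ + _); elim: (t.2) t26 => [_|i m IHm /andP[i26 /IHm Em]] /=.
  by rewrite /monomial big_nil meval1.
by rewrite monomial_cons mevalM Em mevalXU inordK // ofZ_mul.
Qed.

End IntegralPolynomials.

(** * The family zeta and the two invariants *)

Section Zeta.
Variable K : numFieldType.
Local Notation E6 := (E6 K).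
Local Notation elt_of := (elt_of K).
Local Notation ofZ := (ofZ K).
Local Notation xbasis := (xbasis K).
Local Notation A := {mpoly K[26]}.
Local Notation X := (X K).
Local Notation pol_of := (pol_of K).
Implicit Types (z : {ffun 'I_26 -> A}) (u v w : E6).

Lemma V_ind (Q : E6 -> Prop) :
  Q 0 -> (forall c u v, Q u -> Q v -> Q (c *: u + v)) ->
  (forall r, (r < 26)%N -> Q (elt_of (zx r))) -> forall w, in_V w -> Q w.
Proof.
move=> Q0 QL Qx w /in_V_span /coord_span ->; apply: big_ind => // [x y Qu Qv|i _].
  by rewrite -[x]scale1r; apply: QL.
by rewrite -[_ *: _]addr0 xbasis_nth; apply: QL => //; apply: Qx.
Qed.

Lemma bracket_in_V u w : in_F4 u -> in_V w -> in_V (bracket u w).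
Proof.
move=> Fu Vw; apply: span_in_V; elim/V_ind: w / Vw => [|c x y xV yV|r r26].
- by rewrite bracket0r mem0v.
- rewrite bracket_linear_r; apply: memvD; last exact: yV.
  by apply: memvZ; exact: xV.
elim/F4_table_ind: u / Fu => [|c x y xV yV|gt gin].
- by rewrite bracket0l mem0v.
- rewrite bracket_linear_l; apply: memvD; last exact: yV.
  by apply: memvZ; exact: xV.
by have [-> l26] := table_bracket K gin r26; apply: comb_span.
Qed.

Lemma zx_in_V r : (r < 26)%N -> in_V (elt_of (zx r)).
Proof. by move=> r26; apply/span_in_V/xbasis_span. Qed.

Lemma table_in_F4 gt : gt \in table -> in_F4 (elt_of gt.1).
Proof. by move=> gin; apply: gens_in_F4; rewrite -table_gens map_f. Qed.

(** V is generated by x_1.  This yields both the uniqueness of the family zeta and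
    that its span lies in every submodule that contains zeta_1. *)
Lemma V_chain_ind (Q : E6 -> Prop) :
  Q 0 -> (forall c u v, Q u -> Q v -> Q (c *: u + v)) ->
  Q (elt_of (zx 0)) ->
  (forall gt w, gt \in table -> in_V w -> Q w -> Q (bracket (elt_of gt.1) w)) ->
  forall w, in_V w -> Q w.
Proof.
move=> Q0 QL Qx Qbr; apply: V_ind => //; elim/ltn_ind => -[|s] IH s26 //.
have /allP/(_ s.+1) := chain_okP; rewrite mem_iota add1n s26 => /(_ isT).
cbv beta; rewrite succnK; case: (nth _ chain s) =>
  [[r k] c] /and4P[rs kt /eqP step /Z.eqb_eq cc].
have r26 : (r < 26)%N by apply: ltn_trans s26.
have gin := mem_nth (zelt0, [::]) kt.
have := Qbr _ _ gin (zx_in_V r26) (IH _ rs r26).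
have [-> _] := table_bracket K gin r26; rewrite step elt_of_comb big_seq1 /= => Qc.
(* The sign c is its own inverse. *)
have -> : elt_of (zx s.+1) = ofZ c *: (ofZ c *: elt_of (zx s.+1)) + 0.
  by rewrite scalerA -ofZ_mul cc ofZ1 scale1r addr0.
exact: QL.
Qed.

Lemma linext_linear z c u v : linext z (c *: u + v) = c *: linext z u + linext z v.
Proof.
rewrite /linext scaler_sumr -big_split; apply: eq_bigr => i _ /=.
by rewrite linearP scalerDl scalerA.
Qed.

Lemma linext0 z : linext z 0 = 0.
Proof.
by have := linext_linear z (-1) 0 0; rewrite scaler0 addr0 scaleN1r addNr.
Qed.
Lemma linextD z u v : linext z (u + v) = linext z u + linext z v.
Proof. by rewrite -[u]scale1r linext_linear !scale1r. Qed.
Lemma linextZ z c u : linext z (c *: u) = c *: linext z u.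
Proof. by rewrite -[c *: u]addr0 linext_linear linext0 addr0. Qed.

Lemma linext_zx z r : (r < 26)%N -> linext z (elt_of (zx r)) = z (inord r).
Proof.
move=> r26; rewrite /linext (bigD1 (Ordinal r26)) //= coord_zx // eqxx scale1r.
rewrite big1 ?addr0 => [|j ne]; first by congr (z _); apply: val_inj; rewrite /= inordK.
by rewrite coord_zx // eq_sym (negPf (_ : _ != _ :> nat)) ?scale0r.
Qed.

Lemma linext_comb z l : all (fun t => t.2 < 26)%N l ->
  linext z (elt_of (zcomb l)) = \sum_(t <- l) ofZ t.1 *: z (inord t.2).
Proof.
move=> /allP l26; rewrite elt_of_comb (big_morph _ (linextD z) (linext0 z)).
rewrite big_seq [RHS]big_seq; apply: eq_bigr => t /l26 t26.
by rewrite linextZ linext_zx.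
Qed.

Definition zeta_model : {ffun 'I_26 -> A} := [ffun r => pol_of (zeta_pol (r : 'I_26))].

Lemma zeta_modelE r : (r < 26)%N -> zeta_model (inord r) = pol_of (zeta_pol r).
Proof. by move=> r26; rewrite ffunE inordK. Qed.

Lemma zeta_pol_wf r : (r < 26)%N -> zpol_wf (zeta_pol r).
Proof.
by move=> r26; have /andP[/allP wf _] := zetas_okP; apply/wf/mem_nth.
Qed.

Lemma zeta_model_equivariant u w : in_F4 u -> in_V w ->
  linext zeta_model (bracket u w) = F4_act u (linext zeta_model w).
Proof.
move=> Fu Vw; elim/V_ind: w / Vw => [|c x y Ex Ey|r r26].
- rewrite bracket0r linext0; have := F4_act_linear_r u (-1) 0 0.
  by rewrite scaler0 addr0 scaleN1r addNr.
- rewrite bracket_linear_r !linext_linear F4_act_linear_r.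
  by congr (_ *: _ + _); [exact: Ex | exact: Ey].
rewrite [in RHS]linext_zx // zeta_modelE //.
elim/F4_table_ind: u / Fu => [|c x y Ex Ey|gt gin].
- by rewrite bracket0l linext0 F4_act0l.
- rewrite bracket_linear_l linext_linear F4_act_linear_l.
  by congr (_ *: _ + _); [exact: Ex | exact: Ey].
rewrite F4_act_table // table_act_pol_of ?zeta_pol_wf //.
have [-> l26] := table_bracket K gin r26; rewrite linext_comb //.
have /andP[_ /allP/(_ _ gin)/allP/(_ r (mem_iota26 r26))] := zetas_okP.
move=> /(pol_of_eq0 K); rewrite pol_of_cat pol_of_flatten big_map => /eqP.
rewrite addr_eq0 => /eqP ->; rewrite -sumrN big_seq [RHS]big_seq.
apply: eq_bigr => t tin; rewrite pol_of_scale ofZ_opp scaleNr opprK zeta_modelE //.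
by have /allP/(_ _ tin) := l26.
Qed.

(** Evaluation at the point of [zeta_witness s] isolates the coordinate s. *)
Lemma zeta_model_inj w w' : in_V w -> in_V w' ->
  linext zeta_model w = linext zeta_model w' -> w = w'.
Proof.
move=> Vw Vw' E; apply/eqP; rewrite -subr_eq0; apply/eqP.
have dV : w - w' \in <<xbasis>>%VS.
  by apply: memvB; apply: in_V_span.
have E0 : linext zeta_model (w - w') = 0.
  by rewrite -scaleN1r addrC linext_linear E scaleN1r addNr.
rewrite (coord_span dV) big1 // => s _.
have := congr1 (meval (fun i : 'I_26 => ofZ (zindicator (zeta_witness s) i))) E0.
rewrite meval0 /linext (big_morph _ (mevalD _) (meval0 _)).
rewrite (bigD1 s) //= big1 => [|r ne].
  rewrite addr0 mevalZ ffunE zpol_evalP ?zeta_pol_wf //.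
  have /allP/(_ s (mem_iota26 (ltn_ord s)))/allP := zetas_indepP.
  move=> /(_ s (mem_iota26 (ltn_ord s))); rewrite eqxx => /eqP nz.
  move/eqP; rewrite mulf_eq0 => /orP[/eqP ->|]; first by rewrite scale0r.
  by rewrite -[0]ofZ0 (inj_eq (@ofZ_inj K)) => /eqP z; rewrite z in nz.
rewrite mevalZ ffunE zpol_evalP ?zeta_pol_wf //.
have /allP/(_ s (mem_iota26 (ltn_ord s)))/allP := zetas_indepP.
move=> /(_ r (mem_iota26 (ltn_ord r))); rewrite [_ != _]ne => /eqP/Z.eqb_eq ->.
by rewrite ofZ0 mulr0.
Qed.

Lemma zeta1_model : linext zeta_model (xvec K 1) = zeta1 K.
Proof.
rewrite xvecE // linext_zx // zeta_modelE // /zeta_pol (_ : nth _ _ _ = zeta1_pol) //.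
rewrite !pol_of_cons pol_of_nil /fst /snd !monomial_cons /monomial big_nil !ofZ_scale
  !iz_small.
by rewrite /zeta1 /xvar /X /=; ring.
Qed.

Lemma zeta_modelP : is_zeta zeta_model.
Proof.
split; [exact: zeta1_model | exact: zeta_model_equivariant
       | exact: zeta_model_inj | move=> f; split].
  move=> /(_ (fun g => `[< exists2 w, in_V w & linext zeta_model w = g >])).
  move=> gen; apply/asboolP; apply: gen => [|u h Fu /asboolP[w Vw <-]|].
  - split=> [|c p q /asboolP[w Vw <-] /asboolP[w' Vw' <-]]; apply/asboolP.
      by exists 0; [apply/span_in_V/mem0v | exact: linext0].
    exists (c *: w + w'); last exact: linext_linear.
    apply: span_in_V; apply: memvD; last exact: in_V_span.
    by apply: memvZ; exact: in_V_span.
  - apply/asboolP; exists (bracket u w); first exact: bracket_in_V.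
    exact: zeta_model_equivariant.
  apply/asboolP; exists (xvec K 1); last exact: zeta1_model.
  by rewrite xvecE //; exact: zx_in_V.
case=> w Vw <- S [S0 SL] Sact S1.
move: w Vw; apply: V_chain_ind => [|c x y Sx Sy||gt x gin Vx Sx].
- by rewrite linext0.
- by rewrite linext_linear; apply: SL.
- by rewrite -(xvecE K (isT : 0 < 26)%N) zeta1_model.
rewrite zeta_model_equivariant //; last exact: table_in_F4.
by apply: Sact => //; exact: table_in_F4.
Qed.

(** Two equivariant maps that agree at x_1 agree on V. *)
Lemma is_zeta_unique z : is_zeta z -> z = zeta_model.
Proof.
case=> z1 equiv _ _; apply/ffunP => r.
rewrite -[r]inord_val -!linext_zx //.
move: (elt_of _) (zx_in_V (ltn_ord r)).
apply: V_chain_ind => [|c x y Ex Ey||gt x gin Vx Ex].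
- by rewrite !linext0.
- by rewrite !linext_linear; congr (_ *: _ + _); [exact: Ex | exact: Ey].
- by rewrite -(xvecE K (isT : 0 < 26)%N) zeta1_model.
have Fg := table_in_F4 gin.
by rewrite equiv // zeta_model_equivariant //; congr F4_act.
Qed.

Lemma zetaE r : (0 < r < 27)%N -> zeta K r = pol_of (zeta_pol r.-1).
Proof.
move=> /andP[r0 r27]; rewrite /zeta /zeta_family.
rewrite (is_zeta_unique (xgetPex 0 (ex_intro _ _ zeta_modelP))).
by rewrite zeta_modelE //; case: r r0 r27.
Qed.

Lemma eta1E : eta1 = pol_of eta1_pol.
Proof.
rewrite /eta1_pol pol_of_cat [in RHS]/pol_of big_map -/(pol_of _) !pol_of_cons
  pol_of_nil /fst /snd.
rewrite (_ : \sum_(r <- iota 0 12) _ = 3 * \sum_(1 <= r < 13) xvar K r * xvar K (27 - r)).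
  by rewrite /eta1 !ofZ_scale !iz_small !monomial_cons /monomial big_nil /xvar /X /=;
    ring.
rewrite big_add1 /index_iota subn0 mulr_sumr big_seq [RHS]big_seq.
apply: eq_bigr => r; rewrite mem_iota => /andP[_ r12].
have -> : (27 - r.+1 = (25 - r).+1)%N by lia.
by rewrite ofZ_scale iz_small !monomial_cons /monomial big_nil mulr1.
Qed.

Lemma eta2E : eta2 = pol_of eta2_pol.
Proof.
have -> : eta2_pol = zpol_norm eta2_raw by vm_compute.
rewrite pol_of_norm /eta2_raw pol_of_cat pol_of_flatten big_map 3!pol_of_cat
  !pol_of_scale !pol_of_mulX.
rewrite (_ : \sum_(r <- iota 0 12) _ = 3 * \sum_(1 <= r < 13)
    (zeta K r * xvar K (27 - r) + xvar K r * zeta K (27 - r))).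
  rewrite /eta2 !zetaE // !ofZ_scale !iz_small /xvar /X /=; ring.
rewrite big_add1 /index_iota subn0 mulr_sumr.
rewrite big_seq [RHS]big_seq; apply: eq_bigr => r; rewrite mem_iota => /andP[_ r12].
have -> : (27 - r.+1 = (25 - r).+1)%N by lia.
rewrite !zetaE; [|lia|lia].
rewrite pol_of_scale pol_of_cat !pol_of_mulX ofZ_scale iz_small /xvar /X /=; ring.
Qed.

Lemma eta1_invariant : F4_invariant (eta1 : A).
Proof.
apply/F4_invariantP => gt gin; have /andP[/andP[/allP/(_ _ gin)/andP[z _] wf _]] :=
  etas_okP.
by rewrite eta1E table_act_pol_of // pol_of_eq0.
Qed.

Lemma eta2_invariant : F4_invariant (eta2 : A).
Proof.
apply/F4_invariantP => gt gin; have /andP[/andP[/allP/(_ _ gin)/andP[_ z] _ wf]] :=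
  etas_okP.
by rewrite eta2E table_act_pol_of // pol_of_eq0.
Qed.

Lemma invariant_subalg (f g : A) c : F4_invariant f -> F4_invariant g ->
  [/\ F4_invariant (1 : A), F4_invariant (c *: f + g) & F4_invariant (f * g)].
Proof.
move=> If Ig; split=> u Fu.
- exact: F4_act1.
- by rewrite F4_act_linear_r If // Ig // scaler0 addr0.
- by rewrite F4_actM If // Ig // mul0r mulr0 addr0.
Qed.

Lemma generated_invariant (f : A) :
  generated_subalgebra [:: eta1; eta2] f -> F4_invariant f.
Proof.
move=> /(_ (fun g => `[< F4_invariant g >])) gen; apply/asboolP/gen.
  split=> [|c p q /asboolP Ip /asboolP Iq|p q /asboolP Ip /asboolP Iq]; apply/asboolP.
  - by have [] := invariant_subalg 0 eta1_invariant eta1_invariant.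
  - by have [] := invariant_subalg c Ip Iq.
  - by have [] := invariant_subalg 0 Ip Iq.
move=> g; rewrite !inE => /orP[] /eqP -> {g}.
  exact: eta1_invariant.
exact: eta2_invariant.
Qed.

End Zeta.

(** * Invariants vanish if they vanish on the zero weight space *)

Definition zero_weight (i : nat) : bool := (i == 12) || (i == 13).

Definition lcoef (i : nat) (l : seq (Z * nat)) : Z :=
  foldr (fun t x => if t.2 == i then Z.add t.1 x else x) 0%zz l.

(** If x_r has weight w, this holds for the root vector of weight -w (in terms of
    indices from 0): it maps x_r to a nonzero combination of x_13 and x_14,
      and no other x_s to an element
    with a component of weight zero. *)
Definition is_pivot (tab : seq (seq (Z * nat))) (r : nat) : bool :=
  [&& all (fun t => zero_weight t.2) (nth [::] tab r),
      ~~ (Z.eqb (lcoef 12 (nth [::] tab r)) 0%zz &&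
        Z.eqb (lcoef 13 (nth [::] tab r)) 0%zz)
    & all (fun s => (s == r) || all (fun t => ~~ zero_weight t.2) (nth [::] tab s))
        (iota 0 26)].

Lemma pivots_exist :
  all (fun r => zero_weight r || has (fun gt => is_pivot gt.2 r) table) (iota 0 26).
Proof. by vm_compute. Qed.

Section Injectivity.
Variable K : numFieldType.
Local Notation ofZ := (ofZ K).
Local Notation A := {mpoly K[26]}.
Local Notation X := (X K).
Local Notation linform := (linform K).

Lemma mcoeffXM (i : 'I_26) (f : A) m :
  ('X_i * f)@_m = if (0 < m i)%N then f@_(m - U_(i)) else 0.
Proof.
rewrite mulrC; case: ifP => [mi|/negbT mi].
  have le_im : (U_(i) <= m)%MM by rewrite lep1mP -lt0n.
  by rewrite -{1}(submK le_im) addmC mcoeffMX.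
apply: memN_msupp_eq0; rewrite (perm_mem (msuppMX _ _)).
apply/mapP => -[n _ mE]; move: mi; rewrite mE mnmDE mnm1E eqxx add1n; by [].
Qed.

(** The transverse degree: it is 0 for the monomials that do not vanish on the
    zero weight space. *)
Definition tdeg (m : 'X_{1..26}) : nat := \sum_(i < 26 | ~~ zero_weight i) m i.

Lemma tdegD m n : tdeg (m + n)%MM = (tdeg m + tdeg n)%N.
Proof. by rewrite /tdeg -big_split; apply: eq_bigr => i _; rewrite mnmDE. Qed.

Lemma tdegU i : tdeg U_(i)%MM = ~~ zero_weight i.
Proof.
rewrite /tdeg; case: (boolP (zero_weight i)) => zi.
  by apply: big1 => j nj; rewrite mnm1E; case: eqP nj zi => // <- /negPf ->.
rewrite (bigD1 i) //= mnm1E eqxx big1 // => j /andP[_ ne].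
by rewrite mnm1E eq_sym (negPf ne).
Qed.

(** The order of vanishing along the zero weight space is at least k. *)
Definition vanishing (k : nat) (f : A) : Prop :=
  forall m, (tdeg m < k)%N -> f@_m = 0.

Lemma vanishing_linear k c f g :
  vanishing k f -> vanishing k g -> vanishing k (c *: f + g).
Proof. by move=> vf vg m mk; rewrite mcoeffD mcoeffZ vf // vg // mulr0 addr0. Qed.

Lemma vanishing0 k : vanishing k 0.
Proof. by move=> m _; rewrite mcoeff0. Qed.

Lemma vanishing_sum k (I : Type) (s : seq I) (P : pred I) (F : I -> A) :
  (forall i, P i -> vanishing k (F i)) -> vanishing k (\sum_(i <- s | P i) F i).
Proof.
move=> vF; apply: big_ind => //; first exact: vanishing0.
by move=> f g vf vg; rewrite -[f]scale1r; apply: vanishing_linear.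
Qed.

Lemma vanishing_scale k c f : vanishing k f -> vanishing k (c *: f).
Proof.
by move=> vf; rewrite -[_ *: _]addr0; apply: vanishing_linear => //; apply: vanishing0.
Qed.

Lemma vanishing_le k l f : (l <= k)%N -> vanishing k f -> vanishing l f.
Proof. by move=> lk vf m ml; apply: vf; apply: leq_trans lk. Qed.

Lemma vanishing_mulX k (i : 'I_26) f :
  vanishing k f -> vanishing (k + ~~ zero_weight i) ('X_i * f).
Proof.
move=> vf m mk; rewrite mcoeffXM; case: ifP => // mi; apply: vf.
have mE : m = (m - U_(i) + U_(i))%MM by rewrite submK // lep1mP -lt0n.
by move: mk; rewrite {1}mE tdegD tdegU ltn_add2r.
Qed.

Lemma vanishing_deriv k (i : 'I_26) f :
  vanishing k f -> vanishing (k - ~~ zero_weight i) f^`M(i).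
Proof.
move=> vf m mk; rewrite mcoeff_mderiv vf ?mul0rn // tdegD tdegU.
by move: mk; case: (~~ _); lia.
Qed.

(** A nonzero linear form in x_13 and x_14 is not a zero divisor modulo the terms
    of order at least k.  With a != 0, the coefficient of x_i m in the product
    expresses that of m in f by one whose monomial has a lower exponent of
    x_j. *)
Lemma vanishing_cancel k (i j : 'I_26) (a b : K) (f : A) :
  zero_weight i -> zero_weight j -> i != j -> a != 0 ->
  vanishing k (a *: ('X_i * f) + b *: ('X_j * f)) -> vanishing k f.
Proof.
move=> zi zj ij a0 v m; elim: (m j) {-2}m (erefl (m j)) => [|d IH] {}m mj mk.
  have := v (m + U_(i))%MM; rewrite tdegD tdegU zi addn0 => /(_ mk).
  rewrite mcoeffD !mcoeffZ !mcoeffXM !mnmDE !mnm1E eqxx (negPf ij) mj !addn0 addn1 /=.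
  rewrite mulr0 addr0 addmK => /eqP; rewrite mulf_eq0 (negPf a0); by move/eqP.
have := v (m + U_(i))%MM; rewrite tdegD tdegU zi addn0 => /(_ mk).
rewrite mcoeffD !mcoeffZ !mcoeffXM !mnmDE !mnm1E eqxx (negPf ij) mj !addn0 addn1 /=.
rewrite (IH (m + U_(i) - U_(j))%MM).
- rewrite mulr0 addr0 addmK => /eqP; rewrite mulf_eq0 (negPf a0); by move/eqP.
- by rewrite mnmBE mnmDE !mnm1E eqxx (negPf ij) mj; lia.
have := tdegD (m + U_(i) - U_(j))%MM U_(j).
rewrite submK; last by rewrite lep1mP mnmDE mj addSn.
by rewrite tdegD !tdegU zi zj !addn0 => <-.
Qed.

Lemma lin_zero_weight l : all (fun t => zero_weight t.2) l ->
  linform l = ofZ (lcoef 12 l) *: X 12 + ofZ (lcoef 13 l) *: X 13.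
Proof.
elim: l => [_|t l IH /andP[zt /IH E]].
  by rewrite /linform big_nil /= ofZ0 !scale0r addr0.
rewrite /linform big_cons -/(linform l) E /=; case: t zt => c i /= /orP[] /eqP -> /=.
  by rewrite ofZ_add scalerDl addrA.
by rewrite ofZ_add scalerDl addrCA.
Qed.

Lemma zero_weight_inord i : (i < 26)%N -> zero_weight (inord i : 'I_26) = zero_weight i.
Proof. by move=> i26; rewrite inordK. Qed.

Lemma vanishing_lin_mul k l f : all (fun t => t.2 < 26)%N l ->
  all (fun t => ~~ zero_weight t.2) l -> vanishing k f -> vanishing k.+1 (linform l * f).
Proof.
move=> /allP l26 /allP nz vf; rewrite /linform mulr_suml big_seq;
  apply: vanishing_sum => t tin.
rewrite -scalerAl; apply: vanishing_scale.
have := vanishing_mulX (i := inord t.2) vf.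
by rewrite zero_weight_inord ?l26 // nz // addn1.
Qed.

(** The generator acts as l d/dx_r plus terms l_s d/dx_s; here l_s lies in the
    ideal of the variables of nonzero weight, which makes up for the order that
    may be lost by d/dx_s. *)
Lemma vanishing_pivot gt r k f : gt \in table -> is_pivot gt.2 r -> (r < 26)%N ->
  ~~ zero_weight r -> table_act gt.2 f = 0 -> vanishing k f -> vanishing k f^`M(inord r).
Proof.
move=> gin /and3P[/lin_zero_weight E nz /allP other] r26 nzr tf vf.
have : vanishing k (linform (nth [::] gt.2 r) * f^`M(inord r)).
  move: tf; rewrite /table_act (bigD1 (inord r)) //= inordK // => /eqP.
  rewrite addr_eq0 => /eqP ->; rewrite -scaleN1r; apply: vanishing_scale.
  apply: vanishing_sum => s sr.
  have {}sr : (s != r :> nat) by apply: contra sr => /eqP <-; rewrite inord_val.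
  have := other s (mem_iota26 (ltn_ord s)); rewrite (negPf sr) /= => nzs.
  have [_ l26] := table_bracket K gin (ltn_ord s).
  apply: (vanishing_le _ (vanishing_lin_mul l26 nzs (vanishing_deriv (i := s) vf))).
  by case: (~~ _); lia.
rewrite E mulrDl -!scalerAl.
have ne : inord 12 != inord 13 :> 'I_26 by rewrite -val_eqE /= !inordK.
have [z12|nz12] := eqVneq (ofZ (lcoef 12 (nth [::] gt.2 r))) 0; last first.
  by apply: vanishing_cancel nz12; rewrite ?zero_weight_inord.
rewrite addrC; apply: vanishing_cancel; rewrite ?zero_weight_inord 1?eq_sym //.
apply: contra nz => /eqP z13; apply/andP; split; apply/Z.eqb_eq.
  by apply: (@ofZ_inj K); rewrite z12.
by apply: (@ofZ_inj K); rewrite -z13.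
Qed.

(** A monomial of positive order k contains a variable x_r of nonzero weight, and
    d/dx_r turns it into a monomial of order k - 1. *)
Lemma vanishing_step k f : F4_invariant f -> vanishing k.+1 f -> vanishing k.+2 f.
Proof.
move=> /F4_invariantP inv vf m; rewrite ltnS leq_eqVlt => /orP[/eqP mk|]; last exact: vf.
have [r /andP[nzr mr]] : exists r : 'I_26, ~~ zero_weight r && (0 < m r)%N.
  apply/existsP; apply: contraT; rewrite negb_exists => /forallP z.
  suff : tdeg m = 0%N by rewrite mk.
  by apply: big1 => i nzi; have := z i; rewrite nzi /= -eqn0Ngt => /eqP.
have /allP/(_ r (mem_iota26 (ltn_ord r))) := pivots_exist.
rewrite (negPf nzr) => /hasP[gt gin piv].
have le_rm : (U_(r) <= m)%MM by rewrite lep1mP -lt0n.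
have := vanishing_pivot gin piv (ltn_ord r) nzr (inv gt gin) vf.
move=> /(_ (m - U_(r))%MM); rewrite inord_val mcoeff_mderiv submK // mnmBE mnm1E eqxx.
have := tdegD (m - U_(r))%MM U_(r); rewrite submK // tdegU nzr mk addn1.
move=> [<-] /(_ (ltnSn _))/eqP; rewrite subn1 prednK // mulrn_eq0.
by case: eqP mr => [-> //|_ _] /= /eqP.
Qed.

Lemma invariant_eq0 f : F4_invariant f -> vanishing 1 f -> f = 0.
Proof.
move=> inv v1; apply/mpolyP => m; rewrite mcoeff0.
have vk k : vanishing k.+1 f by elim: k => // k; apply: vanishing_step.
exact: (vk (tdeg m)).
Qed.

End Injectivity.

(** * Substitutions and polynomial curves *)

Section Evaluation.
Variable (K : numFieldType) (n : nat).

Definition msubst m (v : 'I_n -> {mpoly K[m]}) (f : {mpoly K[n]}) : {mpoly K[m]} :=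
  mmap (@mpolyC m K) v f.

Section Ev.
Variable (m : nat) (v : 'I_n -> {mpoly K[m]}).

Lemma msubst1 : msubst v 1 = 1. Proof. exact: rmorph1. Qed.
Lemma msubstM f g : msubst v (f * g) = msubst v f * msubst v g. Proof. exact:
  rmorphM. Qed.
Lemma msubstZ c f : msubst v (c *: f) = c *: msubst v f.
Proof. by rewrite /msubst mmapZ mul_mpolyC. Qed.
Lemma msubstD f g : msubst v (f + g) = msubst v f + msubst v g. Proof. exact:
  rmorphD. Qed.
Lemma msubstB f g : msubst v (f - g) = msubst v f - msubst v g. Proof. exact:
  rmorphB. Qed.
Lemma msubstL c f g : msubst v (c *: f + g) = c *: msubst v f + msubst v g.
Proof. by rewrite msubstD msubstZ. Qed.
Lemma msubstX i : msubst v 'X_i = v i.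
Proof. by rewrite /msubst mmapX mmap1U. Qed.

End Ev.

Lemma eq_msubst m (v w : 'I_n -> {mpoly K[m]}) f : v =1 w -> msubst v f = msubst w f.
Proof.
move=> vw; elim/mpoly_alg_ind: f => [|i|a p q Ep Eq|p q Ep Eq].
- by rewrite !msubst1.
- by rewrite !msubstX.
- by rewrite !msubstL; exact: (congr2 (fun x y => a *: x + y) Ep Eq).
- by rewrite !msubstM; exact: (congr2 _ Ep Eq).
Qed.

Section Curve.
Variables (m : nat) (c : 'I_n -> {poly {mpoly K[m]}}).
Local Notation B := {mpoly K[m]}.

Definition along (f : {mpoly K[n]}) : {poly B} :=
  mmap (polyC \o @mpolyC m K) c f.

Lemma along1 : along 1 = 1. Proof. exact: rmorph1. Qed.
Lemma alongM f g : along (f * g) = along f * along g. Proof. exact: rmorphM. Qed.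
Lemma alongX i : along 'X_i = c i.
Proof. by rewrite /along mmapX mmap1U. Qed.

Lemma along0 : along 0 = 0. Proof. exact: rmorph0. Qed.
Lemma alongD f g : along (f + g) = along f + along g. Proof. exact: rmorphD. Qed.
Lemma alongZ a f : along (a *: f) = a%:MP%:P * along f. Proof. exact: mmapZ. Qed.
Lemma alongL a f g : along (a *: f + g) = a%:MP%:P * along f + along g.
Proof. by rewrite alongD alongZ. Qed.

Lemma along_horner f (b : B) : (along f).[b] = msubst (fun i => (c i).[b]) f.
Proof.
elim/mpoly_alg_ind: f => [|i|a p q Ep Eq|p q Ep Eq].
- by rewrite along1 msubst1 hornerC.
- by rewrite alongX msubstX.
- rewrite alongL msubstL hornerD hornerM hornerC mul_mpolyC.
  exact: (congr2 (fun x y => a *: x + y) Ep Eq).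
- by rewrite alongM msubstM hornerM; exact: (congr2 _ Ep Eq).
Qed.

Lemma leibniz_aux (R : comNzRingType) (u x y z w : R) :
  u * x * y + z * (u * w) = u * (x * y + z * w).
Proof. by ring. Qed.

(** The chain rule. *)
Lemma deriv_along f : (along f)^`() = \sum_i (c i)^`() * along f^`M(i).
Proof.
elim/mpoly_alg_ind: f => [|i|a p q Ep Eq|p q Ep Eq].
- rewrite along1 derivC big1 // => i _.
  by rewrite -(mpolyC1 n K) mderivC along0 mulr0.
- rewrite alongX (bigD1 i) //= mderiv_X eqxx along1 mulr1 big1 ?addr0 // => j ne.
  by rewrite mderiv_X eq_sym (negPf ne) along0 mulr0.
- rewrite alongL derivD derivM derivC mul0r add0r.
  apply: (etrans (congr2 (fun x y => a%:MP%:P * x + y) Ep Eq)); cbv beta.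
  rewrite mulr_sumr -big_split.
  apply: eq_bigr => i _; rewrite mderivD mderivZ alongL.
  by rewrite mulrDr (mulrCA a%:MP%:P).
rewrite alongM derivM.
apply: (etrans (congr2 (fun x y => x * along q + along p * y) Ep Eq)); cbv beta.
rewrite mulr_suml mulr_sumr -big_split.
apply: eq_bigr => i _; rewrite mderivM alongD !alongM.
exact: (leibniz_aux (c i)^`() (along p^`M(i)) (along q) (along p) (along q^`M(i))).
Qed.

End Curve.

Lemma deriv_eq0_const m (p : {poly {mpoly K[m]}}) a b : p^`() = 0 -> p.[a] = p.[b].
Proof.
move=> p'0; suff -> : p = (p`_0)%:P by rewrite !hornerC.
apply/polyP => -[|i]; rewrite coefC //=.
have := congr1 (fun q : {poly _} => q`_i) p'0.
rewrite coef_deriv coef0 -scaler_nat => /eqP.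
by rewrite scaler_eq0 pnatr_eq0 /= => /eqP.
Qed.

End Evaluation.

(** * Reflections *)

(** Some generator acts on the x_s by the given rows modulo the variables outside
    W.  If the rows outside W are empty, its vector field is tangent to the
    subspace where those variables vanish. *)
Definition restricted_to (W : seq nat) (row : nat -> seq (Z * nat)) : bool :=
  has (fun gt => all (fun s => [seq t <- nth [::] gt.2 s | t.2 \in W] == row s) (iota
    0 26))
    table.

(** Up to signs, the root vector e with the weight of the variable of index r and
    its opposite act on the span of this variable, of the one of index 25 - r, and
    of x_13 and x_14 as on the sum of the adjoint and the trivial representation
    of sl_2.  Here j is the index of the zero weight vector to which the opposite
    root vector maps the variable of index r, and k is the other one of 12 and
    13. *)
Definition raising (r j k s : nat) : seq (Z * nat) :=
  if s == (25 - r)%N then [:: ((-1)%zz, j)] else if s == j then [:: ((-2)%zz, r)]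
  else if s == k then [:: (1%zz, r)] else [::].

Definition lowering (r j k s : nat) : seq (Z * nat) :=
  if s == r then [:: (1%zz, j)] else if s == j then [:: (2%zz, (25 - r)%N)]
  else if s == k then [:: ((-1)%zz, (25 - r)%N)] else [::].

Definition sl2_string (r j k : nat) : bool :=
  restricted_to [:: r; (25 - r)%N; j; k] (raising r j k)
  && restricted_to [:: r; (25 - r)%N; j; k] (lowering r j k).

(** These are the strings of x_12 and x_11. *)
Lemma simple_strings : sl2_string 11 12 13 && sl2_string 10 13 12.
Proof. by vm_compute. Qed.

Section Reflection.
Variables (K : numFieldType) (m : nat).
Local Notation ofZ := (ofZ K).
Local Notation A := {mpoly K[26]}.
Local Notation B := {mpoly K[m]}.
Local Notation linform := (linform K).

Definition at_point (v : nat -> B) (f : A) : B := msubst (fun i : 'I_26 => v i) f.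

(** The velocity of c is the value along c of the vector field of a generator, so
    the derivative of f along c is the value of the image of f under this
    generator, which is 0. *)
Lemma flow_invariance (f : A) W row (c : nat -> {poly B}) (v w : nat -> B) :
  F4_invariant f -> restricted_to W row ->
  (forall s, s \notin W -> c s = 0) ->
  (forall s, (s < 26)%N -> (c s)^`() = \sum_(t <- row s) (ofZ t.1)%:MP%:P * c t.2) ->
  (forall s, (s < 26)%N -> (c s).[0] = v s) ->
  (forall s, (s < 26)%N -> (c s).[1] = w s) -> at_point v f = at_point w f.
Proof.
move=> /F4_invariantP inv /hasP[gt gin /allP rowE] c0 c' cv cw.
pose d (i : 'I_26) := c i.
rewrite /at_point -(@eq_msubst _ _ _ (fun i : 'I_26 => (d i).[0])) => [|i];
  last exact: cv.
rewrite -[RHS](@eq_msubst _ _ _ (fun i : 'I_26 => (d i).[1])) => [|i]; last exact: cw.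
rewrite -!along_horner; apply: deriv_eq0_const; rewrite deriv_along.
transitivity (along d (table_act gt.2 f)); last by rewrite inv // along0.
rewrite /table_act (big_morph _ (alongD d) (along0 d)); apply: eq_bigr => s _.
rewrite alongM; congr (_ * _).
have s26 := ltn_ord s; have [_ /allP l26] := table_bracket K gin s26.
rewrite /d c' // -(eqP (rowE s (mem_iota26 s26))) big_filter.
rewrite /linform (big_morph _ (alongD d) (along0 d)) big_mkcond big_seq [RHS]big_seq.
apply: eq_bigr => t /l26 t26; rewrite alongZ alongX /d inordK //.
by case: ifP => // /negbT /c0 ->; rewrite mulr0.
Qed.

Definition string_pt (V : zmodType) (r j k : nat) (x y a b : V) (s : nat) : V :=
  if s == r then x else if s == (25 - r)%N then y else if s == j then a
  else if s == k then b else 0.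

Lemma ofZ_small :
  ((ofZ 1%zz = 1) * (ofZ 2%zz = 2) * (ofZ (-1)%zz = -1) * (ofZ (-2)%zz = -2))%type.
Proof. by []. Qed.

Section String.
Variables r j k : nat.
Let W : seq nat := [:: r; (25 - r)%N; j; k].
Hypothesis uniqW : uniq W.

Lemma string_ptE (V : zmodType) (x y a b : V) (pt := string_pt r j k x y a b) :
  ((pt r = x) * (pt (25 - r)%N = y) * (pt j = a) * (pt k = b))%type.
Proof.
move: uniqW; rewrite /= !inE !negb_or => /and4P[/and3P[e1 e2 e3] /andP[e4 e5] e6 _].
rewrite /pt /string_pt !eqxx (eq_sym _ r) (negPf e1) (eq_sym j) (negPf e2) (eq_sym j).
by rewrite (negPf e4) !(eq_sym k) (negPf e3) (negPf e5) (negPf e6).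
Qed.

Lemma string_pt_out (V : zmodType) (x y a b : V) s :
  s \notin W -> string_pt r j k x y a b s = 0.
Proof.
by rewrite !inE !negb_or /string_pt => /and4P[/negPf -> /negPf -> /negPf -> /negPf ->].
Qed.

Lemma raisingE (row := raising r j k) :
  ((row r = [::]) * (row (25 - r)%N = [:: ((-1)%zz, j)]) * (row j = [:: ((-2)%zz, r)])
   * (row k = [:: (1%zz, r)]))%type.
Proof.
move: uniqW; rewrite /= !inE !negb_or => /and4P[/and3P[e1 e2 e3] /andP[e4 e5] e6 _].
rewrite /row /raising !eqxx (negPf e1) (negPf e2) (negPf e3) (eq_sym j) (negPf e4).
by rewrite !(eq_sym k) (negPf e5) (negPf e6).
Qed.

Lemma loweringE (row := lowering r j k) :
  ((row r = [:: (1%zz, j)]) * (row (25 - r)%N = [::]) * (row j = [:: (2%zz, (25 - r)%N)])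
   * (row k = [:: ((-1)%zz, (25 - r)%N)]))%type.
Proof.
move: uniqW; rewrite /= !inE !negb_or => /and4P[/and3P[e1 e2 e3] /andP[e4 e5] e6 _].
rewrite /row /lowering !eqxx (eq_sym _ r) (negPf e1) (eq_sym j) (negPf e2) (negPf e4).
by rewrite (negPf e5) !(eq_sym k) (negPf e3) (negPf e6).
Qed.

Lemma row_out s : s \notin W -> (raising r j k s = [::]) * (lowering r j k s = [::]).
Proof.
by rewrite !inE !negb_or /raising /lowering
  => /and4P[/negPf -> /negPf -> /negPf -> /negPf ->].
Qed.

Lemma string_cases (P : nat -> Prop) :
  P r -> P (25 - r)%N -> P j -> P k -> (forall s, s \notin W -> P s) -> forall s, P s.
Proof.
move=> Pr Pr' Pj Pk Pout s; have [|] := boolP (s \in W); last exact: Pout.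
by rewrite !inE => /or4P[] /eqP ->.
Qed.

(** The exponential of the raising operator, at a point whose coordinate of
    index r is 0. *)
Lemma raising_flow f (y a b : B) :
  sl2_string r j k -> F4_invariant f ->
  at_point (string_pt r j k 0 y a b) f = at_point (string_pt r j k 0 (y - a) a b) f.
Proof.
move=> /andP[up _] inv.
pose c := string_pt r j k 0 (y%:P - 'X * a%:P) a%:P b%:P.
apply: (flow_invariance (c := c) inv up); first by move=> s; exact: string_pt_out.
- move=> s _; rewrite /c; move: s; apply: string_cases => [||||s /[dup] /row_out ->
  /string_pt_out ->];
    rewrite ?raisingE ?string_ptE ?big_nil ?big_seq1 /= ?string_ptE ?ofZ_small.
  + by rewrite derivC.
  + by rewrite derivB derivC derivM derivX derivC mpolyCN mpolyC1 polyCN; ring.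
  + by rewrite derivC mulr0.
  + by rewrite derivC mulr0.
  + by rewrite derivC.
- move=> s _; rewrite /c; move: s; apply: string_cases => [||||s so];
  rewrite ?string_ptE ?string_pt_out //;
    rewrite ?hornerC //.
  by rewrite hornerD hornerN hornerM hornerX !hornerC mul0r subr0.
move=> s _; rewrite /c; move: s; apply: string_cases => [||||s so];
  rewrite ?string_ptE ?string_pt_out //;
  rewrite ?hornerC //.
by rewrite hornerD hornerN hornerM hornerX !hornerC mul1r.
Qed.

(** The exponential of the lowering operator.  The value of y is the one for which
    the coordinate of index r is again 0 at time 1. *)
Lemma lowering_flow f (a b : B) :
  sl2_string r j k -> F4_invariant f ->
  at_point (string_pt r j k 0 (- a) a b) f = at_point (string_pt r j k 0 (- a) (- a)
    (a + b)) f.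
Proof.
move=> /andP[_ down] inv.
pose c := string_pt r j k ('X * a%:P - 'X * ('X * a%:P)) (- a)%:P (a%:P - ('X * a%:P
  + 'X * a%:P)) (b%:P + 'X * a%:P).
apply: (flow_invariance (c := c) inv down); first by move=> s; exact: string_pt_out.
- move=> s _; rewrite /c; move: s; apply: string_cases => [||||s /[dup] /row_out ->
  /string_pt_out ->];
    rewrite ?loweringE ?string_ptE ?big_nil ?big_seq1 /= ?string_ptE ?ofZ_small.
  + by rewrite !(derivB, derivM, derivX, derivC) mpolyC1; ring.
  + by rewrite derivC.
  + by rewrite !(derivB, derivD, derivM, derivX, derivC) polyCN mpolyC_nat
    rmorph_nat; ring.
  + by rewrite !(derivD, derivM, derivX, derivC) polyCN mpolyCN mpolyC1; ring.
  + by rewrite derivC.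
- move=> s _; rewrite /c; move: s; apply: string_cases => [||||s so];
  rewrite ?string_ptE ?string_pt_out //;
  by rewrite !(hornerD, hornerN, hornerM, hornerX, hornerC); ring.
move=> s _; rewrite /c; move: s; apply: string_cases => [||||s so];
  rewrite ?string_ptE ?string_pt_out //;
by rewrite !(hornerD, hornerN, hornerM, hornerX, hornerC); ring.
Qed.

(** The path (x, y, a) = (0, 0, a), (0, -a, a), (0, -a, -a), (0, 0, -a) realises
    exp(e) exp(e') exp(e). *)
Lemma reflection f (a b : B) :
  sl2_string r j k -> F4_invariant f ->
  at_point (string_pt r j k 0 0 a b) f = at_point (string_pt r j k 0 0 (- a) (a + b)) f.
Proof.
move=> str inv; rewrite (raising_flow _ _ _ str inv) sub0r (lowering_flow _ _ str inv).
by rewrite (raising_flow _ _ _ str inv) opprK addNr.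
Qed.

End String.

Definition cartan_pt (V : zmodType) (a b : V) (s : nat) : V :=
  if s == 12 then a else if s == 13 then b else 0.

Lemma eq_at_point (v w : nat -> B) f : v =1 w -> at_point v f = at_point w f.
Proof. by move=> vw; apply: eq_msubst => i. Qed.

Lemma reflections f (a b : B) : F4_invariant f ->
  at_point (cartan_pt a b) f = at_point (cartan_pt (- a) (a + b)) f
  /\ at_point (cartan_pt a b) f = at_point (cartan_pt (a + b) (- b)) f.
Proof.
move=> inv; have /andP[s1 s2] := simple_strings.
have E1 x y s : string_pt 11 12 13 0 0 x y s = cartan_pt x y s :> B.
  rewrite /string_pt /cartan_pt; have [-> //|_] := eqVneq s 11.
  by have [-> //|_] := eqVneq s (25 - 11)%N.
have E2 x y s : string_pt 10 13 12 0 0 y x s = cartan_pt x y s :> B.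
  rewrite /string_pt /cartan_pt; have [-> //|_] := eqVneq s 10.
  by have [-> //|_] := eqVneq s (25 - 10)%N; have [-> //|_] := eqVneq s 13.
split.
  rewrite -(eq_at_point _ (E1 _ _)) -[RHS](eq_at_point _ (E1 _ _)).
  exact: reflection.
rewrite -(eq_at_point _ (E2 _ _)) -[RHS](eq_at_point _ (E2 _ _)) addrC.
exact: reflection.
Qed.

End Reflection.

(** * Restriction to the zero weight space *)

Section Restriction.
Variable K : numFieldType.
Local Notation A := {mpoly K[26]}.
Local Notation B := {mpoly K[3]}.
Local Notation X := (X K).
Local Notation pol_of := (pol_of K).

Lemma msubst_comp n m p (v : 'I_n -> {mpoly K[m]}) (w : 'I_m -> {mpoly K[p]}) f :
  msubst w (msubst v f) = msubst (fun i => msubst w (v i)) f.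
Proof.
elim/mpoly_alg_ind: f => [|i|a q r Eq Er|q r Eq Er].
- by rewrite !msubst1.
- by rewrite !msubstX.
- by rewrite !msubstL; exact: (congr2 (fun x y => a *: x + y) Eq Er).
- by rewrite !msubstM; exact: (congr2 _ Eq Er).
Qed.

Definition restriction (f : A) : A := at_point (cartan_pt (X 12) (X 13)) f.

Lemma restriction1 : restriction 1 = 1. Proof. exact: msubst1. Qed.
Lemma restriction0 : restriction 0 = 0. Proof. exact: mmap0. Qed.
Lemma restrictionM f g : restriction (f * g) = restriction f * restriction g.
Proof. exact: msubstM. Qed.
Lemma restrictionL a f g :
  restriction (a *: f + g) = a *: restriction f + restriction g.
Proof. exact: msubstL. Qed.

Lemma restriction_X i : (i < 26)%N -> restriction (X i) =
  if zero_weight i then X i else 0.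
Proof.
move=> i26; rewrite /restriction /at_point msubstX inordK // /cartan_pt /zero_weight.
by case: eqP => [-> //|_]; case: eqP => [-> //|_].
Qed.

Lemma restriction_pI p : zpol_wf p ->
  restriction (pol_of p) = pol_of [seq t <- p | all zero_weight t.2].
Proof.
elim: p => [_|t p IH /andP[t26 /IH E]]; first by rewrite pol_of_nil restriction0.
rewrite pol_of_cons restrictionL E /=.
have -> : restriction (monomial K t.2) = if all zero_weight t.2 then monomial K t.2
  else 0.
  elim: (t.2) t26 => [_|i m IHm /andP[i26 /IHm Em]] /=;
    first by rewrite /monomial big_nil restriction1.
  rewrite monomial_cons restrictionM Em.
  by rewrite restriction_X //; case: ifP => _ /=; [case: ifP => _;
    rewrite ?mulr0 | rewrite mul0r].
by case: ifP => _; [rewrite pol_of_cons | rewrite scaler0 add0r].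
Qed.

Lemma restriction_eta1 :
  restriction eta1 = - (X 12 ^+ 2 + X 12 * X 13 + X 13 ^+ 2).
Proof.
have /andP[/andP[_ wf] _] := etas_okP; rewrite eta1E restriction_pI //.
rewrite (_ : [seq _ <- _ | _] = [:: ((-1)%zz, [:: 12; 12]); ((-1)%zz, [:: 12; 13]);
  ((-1)%zz, [:: 13; 13])]); last by vm_compute.
rewrite !pol_of_cons pol_of_nil /fst /snd !monomial_cons /monomial big_nil !ofZ_scale
  !iz_small; ring.
Qed.

Lemma restriction_eta2 :
  restriction eta2 = (2 * X 12 + X 13) * (X 12 - X 13) * (X 12 + 2 * X 13).
Proof.
have /andP[/andP[_ _] wf] := etas_okP; rewrite eta2E restriction_pI //.
rewrite (_ : [seq _ <- _ | _] = [:: ((-3)%zz, [:: 12; 13; 13]); ((-2)%zz, [:: 13; 13;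
  13]);
  (3%zz, [:: 12; 12; 13]); (2%zz, [:: 12; 12; 12])]); last by vm_compute.
rewrite !pol_of_cons pol_of_nil /fst /snd !monomial_cons /monomial big_nil !ofZ_scale
  !iz_small; ring.
Qed.

Lemma vanishing_mul k (g f : A) : vanishing k f -> vanishing k (g * f).
Proof.
elim/mpoly_alg_ind: g f => [|i|a p q vp vq|p q vp vq] f vf.
- by rewrite mul1r.
- by apply: vanishing_le (vanishing_mulX (i := i) vf); apply: leq_addr.
- by rewrite mulrDl -scalerAl; apply: vanishing_linear; [exact: vp | exact: vq].
- by rewrite -mulrA; apply: vp; exact: vq.
Qed.

(** The kernel of the restriction is the ideal of the variables of nonzero
    weight. *)
Lemma vanishing_restriction (f : A) : vanishing 1 (f - restriction f).
Proof.
elim/mpoly_alg_ind: f => [|s|a p q vp vq|p q vp vq].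
- by rewrite restriction1 subrr; exact: vanishing0.
- rewrite -[s]inord_val -/(X s) restriction_X //.
  case: (boolP (zero_weight s)) => zi; first by rewrite subrr; exact: vanishing0.
  have v0 : vanishing 0 (1 : A) by [].
  have := vanishing_mulX (i := s) v0.
  by rewrite subr0 mulr1 zi /X inord_val.
- rewrite restrictionL opprD addrACA -scalerBr.
  by apply: vanishing_linear; [exact: vp | exact: vq].
rewrite restrictionM (_ : p * q - _ = restriction q * (p - restriction p) + p * (q -
  restriction q)).
  rewrite -[X in X + _]scale1r.
  by apply: vanishing_linear; apply: vanishing_mul; [exact: vp | exact: vq].
by ring.
Qed.

Lemma invariant_eq (f g : A) : F4_invariant f -> F4_invariant g ->
  restriction f = restriction g -> f = g.
Proof.
move=> If Ig E; apply/eqP; rewrite -subr_eq0; apply/eqP/invariant_eq0.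
  by rewrite addrC -scaleN1r; have [_ I _] := invariant_subalg (-1) Ig If.
have -> : f - g = (-1) *: (g - restriction g) + (f - restriction f).
  by rewrite E scaleN1r opprB [RHS]addrC addrA subrK.
by apply: vanishing_linear; exact: vanishing_restriction.
Qed.

(** * Symmetric polynomials *)

Definition tvar (i : nat) : B := 'X_(inord i).

(** In these coordinates the two reflections are transpositions. *)
Definition cartan_fun (f : A) (a b c : B) : B := at_point (cartan_pt (a - b) (b - c)) f.

Lemma cartan_fun_swap (f : A) (a b c : B) : F4_invariant f ->
  cartan_fun f a b c = cartan_fun f b a c /\ cartan_fun f a b c = cartan_fun f a c b.
Proof.
move=> inv; rewrite /cartan_fun; have [E1 E2] := reflections (a - b) (b - c) inv.
by split; [rewrite E1 opprB addrA subrK | rewrite E2 opprB addrA subrK].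
Qed.

Lemma ord3 (i : 'I_3) : [\/ i = inord 0, i = inord 1 | i = inord 2].
Proof.
case: i => [[|[|[|//]]] lt]; [apply: Or31 | apply: Or32 | apply: Or33];
  by apply: val_inj; rewrite /= inordK.
Qed.

Lemma symmetric3 (T V : Type) (x : 'I_3 -> T) (h : T -> T -> T -> V) :
  (forall a b c, h a b c = h b a c) -> (forall a b c, h a b c = h a c b) ->
  forall p q r : 'I_3, uniq [:: p; q; r] ->
  h (x p) (x q) (x r) = h (x (inord 0)) (x (inord 1)) (x (inord 2)).
Proof.
move=> sw ws p q r.
have [-> | -> | ->] := ord3 p; have [-> | -> | ->] := ord3 q;
  have [-> | -> | ->] := ord3 r; rewrite /= !inE ?eqxx ?orbT ?andbF //= => _ //.
- by rewrite [LHS]ws [LHS]sw.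
- by rewrite [LHS]sw [LHS]ws.
- by rewrite [LHS]ws [LHS]sw [LHS]ws.
Qed.

Lemma cartan_fun_symmetric f : F4_invariant f ->
  cartan_fun f (tvar 0) (tvar 1) (tvar 2) \is symmetric.
Proof.
move=> inv; apply/issymP => s.
have -> : msym s (cartan_fun f (tvar 0) (tvar 1) (tvar 2))
  = cartan_fun f 'X_(s (inord 0 : 'I_3)) 'X_(s (inord 1 : 'I_3)) 'X_(s (inord 2 : 'I_3)).
  rewrite -[LHS]/(msubst (fun i => 'X_(s i)) _) /cartan_fun /at_point msubst_comp.
  apply: eq_msubst => i; rewrite /cartan_pt.
  case: ifP => _; first by rewrite msubstB !msubstX.
  case: ifP => _; first by rewrite msubstB !msubstX.
  exact: mmap0.
apply: (@symmetric3 _ _ (fun i => 'X_i) (cartan_fun f)) => [a b c|a b c|].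
- by have [] := cartan_fun_swap a b c inv.
- by have [] := cartan_fun_swap a b c inv.
by rewrite /= !inE !(inj_eq perm_inj) -!val_eqE /= !inordK.
Qed.

Lemma mesym_3_1 : mesym 3 K 1 = tvar 0 + tvar 1 + tvar 2.
Proof.
rewrite mesym1E !big_ord_recl big_ord0 addr0 addrA /tvar.
by congr ('X_ _ + 'X_ _ + 'X_ _); apply: val_inj; rewrite /= inordK.
Qed.

Lemma mesym_3_3 : mesym 3 K 3 = tvar 0 * tvar 1 * tvar 2.
Proof.
rewrite mesymnnE !big_ord_recl big_ord0 mulr1 mulrA /tvar.
by congr ('X_ _ * 'X_ _ * 'X_ _); apply: val_inj; rewrite /= inordK.
Qed.

Lemma mesym_3_2 : mesym 3 K 2 = tvar 0 * tvar 1 + (tvar 0 + tvar 1) * tvar 2.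
Proof.
rewrite mesymSS mesymnnE mesym1E !big_ord_recl !big_ord0 mulr1 addr0.
rewrite mwidenM mwidenD !mwidenX !mnmwiden1 /tvar.
by congr ('X_ _ * 'X_ _ + ('X_ _ + 'X_ _) * 'X_ _); apply: val_inj; rewrite /= inordK.
Qed.

(** The t_i of sum zero for which x_13 = t_0 - t_1 and x_14 = t_1 - t_2. *)
Definition tau (i : nat) : A :=
  3^-1 *: nth 0 [:: 2 * X 12 + X 13; X 13 - X 12; - (X 12 + 2 * X 13)] i.

Definition to_cartan (p : B) : A := msubst (fun i : 'I_3 => tau i) p.

Lemma to_cartan_t i : (i < 3)%N -> msubst (fun i : 'I_3 => tau i) (tvar i) = tau i.
Proof. by move=> i3; rewrite msubstX inordK. Qed.

Lemma scale_third (x : A) : 3^-1 *: (3 * x) = x.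
Proof.
by rewrite mulr_natl -scaler_nat scalerA mulVf ?scale1r ?pnatr_eq0.
Qed.

Lemma restriction_cartan_fun f :
  to_cartan (cartan_fun f (tvar 0) (tvar 1) (tvar 2)) = restriction f.
Proof.
rewrite /to_cartan /cartan_fun /restriction /at_point msubst_comp.
apply: eq_msubst => i; rewrite /cartan_pt; case: ifP => _.
  rewrite msubstB !to_cartan_t // /tau /= -scalerBr.
  by rewrite (_ : _ - _ = 3 * X 12) ?scale_third //; ring.
case: ifP => _; last exact: mmap0.
rewrite msubstB !to_cartan_t // /tau /= -scalerBr.
by rewrite (_ : _ - _ = 3 * X 13) ?scale_third //; ring.
Qed.

Lemma tau_mesym1 : to_cartan (mesym 3 K 1) = 0.
Proof.
rewrite mesym_3_1 /to_cartan !msubstD !to_cartan_t // /tau /= -!scalerDr.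
by rewrite (_ : _ + _ = 0) ?scaler0 //; ring.
Qed.

Lemma tau_mesym2 : to_cartan (mesym 3 K 2) = restriction (3^-1 *: eta1).
Proof.
rewrite mesym_3_2 /to_cartan !(msubstD, msubstM) !to_cartan_t // /tau /=.
rewrite -[3^-1 *: eta1]addr0 restrictionL restriction0 addr0 restriction_eta1.
rewrite -!scalerDr -!scalerAl -!scalerAr -!scalerDr; congr (_ *: _).
rewrite -[RHS]scale_third; congr (_ *: _); ring.
Qed.

Lemma tau_mesym3 : to_cartan (mesym 3 K 3) = restriction (27^-1 *: eta2).
Proof.
rewrite mesym_3_3 /to_cartan !msubstM !to_cartan_t // /tau /=.
rewrite -[27^-1 *: eta2]addr0 restrictionL restriction0 addr0 restriction_eta2.
rewrite -!scalerAl -!scalerAr -!scalerAl !scalerA; congr (_ *: _); last by ring.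
rewrite -!invfM; congr (_^-1); ring.
Qed.

(** Their restrictions are the elementary symmetric functions of the [tau]; the
    restriction of eta_2 is (2 x_13 + x_14) (x_13 - x_14) (x_13 + 2 x_14), that
    is 27 times the product of the [tau]. *)
Definition basic_invariant (i : nat) : A :=
  nth 0 [:: 0; 3^-1 *: eta1; 27^-1 *: eta2] i.

Lemma tau_mesym (i : 'I_3) : to_cartan (mesym 3 K i.+1) = restriction (basic_invariant i).
Proof.
case: i => [[|[|[|//]]] lt] /=.
- by rewrite tau_mesym1 restriction0.
- exact: tau_mesym2.
- exact: tau_mesym3.
Qed.

Lemma generated_basic (p : B) :
  generated_subalgebra [:: eta1; eta2] (msubst (fun i : 'I_3 => basic_invariant i) p).
Proof.
move=> S [S1 SL SM] Seta.
have S0 : 0 \in S by rewrite -(addNr 1) -scaleN1r; apply: SL.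
have SZ a f : f \in S -> a *: f \in S.
  by move=> Sf; rewrite -[_ *: f]addr0; apply: SL.
elim/mpoly_alg_ind: p => [|i|a q r Sq Sr|q r Sq Sr].
- by rewrite msubst1.
- rewrite msubstX /basic_invariant; case: i => [[|[|[|//]]] lt] //=.
    by apply/SZ/Seta; rewrite inE eqxx.
  by apply/SZ/Seta; rewrite !inE eqxx orbT.
- by rewrite msubstL; apply: SL; [exact: Sq | exact: Sr].
- by rewrite msubstM; apply: SM; [exact: Sq | exact: Sr].
Qed.

Lemma invariant_generated (f : A) :
  F4_invariant f -> generated_subalgebra [:: eta1; eta2] f.
Proof.
move=> inv; have [p [pE _]] := sym_fundamental (cartan_fun_symmetric inv).
suff -> : f = msubst (fun i : 'I_3 => basic_invariant i) p by exact: generated_basic.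
apply: invariant_eq => //; first exact/generated_invariant/generated_basic.
rewrite -restriction_cartan_fun -pE -[_ \mPo _]/(msubst _ p) /to_cartan msubst_comp.
rewrite {1}/restriction /at_point [RHS]msubst_comp; apply: eq_msubst => i.
by rewrite tnth_mktuple; exact: tau_mesym.
Qed.

End Restriction.

Theorem corollary3p2 (R : realType) (f : {mpoly R[i][26]}) :
  F4_invariant f <-> generated_subalgebra [:: eta1; eta2] f.
Proof.
split; first exact: invariant_generated.
exact: generated_invariant.
Qed.
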